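(* For $f$ a degree-$d$ polynomial threshold function in $n$ variables and $c>0$, $$\mathrm{GAS}(f)=O_{c,d}(n^{5/6+c}).$$
   Context: A degree-$d$ polynomial threshold function is $f(x)=\mathrm{sgn}(p(x))$ with $p$ a real polynomial of degree at most $d$. The Gaussian average sensitivity is $\mathrm{GAS}(f)=\sum_{i=1}^n\Pr(f(X)\ne f(X^{(i)}))$, where $X$ is a standard $n$-dimensional Gaussian and $X^{(i)}$ is obtained from $X$ by replacing its $i$-th coordinate by an independent standard Gaussian. $O_{c,d}(M)$ denotes a quantity bounded by $M$ times a constant depending only on $c,d$. *)

(* Defs.v *)
From HB Require Import structures.
From mathcomp Require Import all_boot all_order all_algebra.
From mathcomp Require Import all_classical all_reals all_analysis.
From mathcomp Require mpoly.

Set Implicit Arguments.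
Unset Strict Implicit.
Unset Printing Implicit Defensive.

Import Order.TTheory GRing.Theory Num.Theory.
Local Open Scope classical_set_scope.
Local Open Scope ring_scope.

Section GAS.
Context {R : realType}.

Definition stdnormal : set R -> \bar R := normal_prob (0:R) 1.

Definition upd (x : nat -> R) (k : nat) (t : R) : nat -> R :=
  fun j => if j == k then t else x j.

(** Iterated integral of F against N(0,1) in each of the coordinates
    0, ..., k-1 (the other coordinates of x are kept fixed).  This is the
    expectation of F under the k-fold product (standard Gaussian) measure,
    built by iterating one-dimensional integrals, as product measures are. *)
Fixpoint gauss_iter (k : nat) (F : (nat -> R) -> \bar R) (x : nat -> R)
  : \bar R :=
  match k with
  | 0 => F x
  | k'.+1 => (\int[stdnormal]_t gauss_iter k' F (upd x k' t))%E
  end.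

Definition gauss_expect (k : nat) (F : (nat -> R) -> \bar R) : \bar R :=
  gauss_iter k F (fun _ => 0).

Definition sgn (x : R) : R := if 0 <= x then 1 else -1.

Definition tdeg (n : nat) (p : mpoly.mpoly n R) : nat :=
  (\max_(m <- mpoly.msupp p) mpoly.mdeg m)%N.

Definition ptf (n : nat) (p : mpoly.mpoly n R) (x : 'I_n -> R) : R :=
  sgn (mpoly.meval x p).

(** Gaussian average sensitivity:
    sum_i Pr(f(X) <> f(X^(i))), where X = (Z_0,...,Z_{n-1}) and X^(i)
    replaces Z_i by the independent standard Gaussian Z_n. *)
Definition GAS (n : nat) (f : ('I_n -> R) -> R) : \bar R :=
  (\sum_(i < n)
     gauss_expect n.+1 (fun z =>
       (\1_[set z' : nat -> R |
              f (fun j : 'I_n => z' j) != f (fun j : 'I_n => upd z' i (z' n) j)]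
          z)%:E))%E.

End GAS.

(* Main.v *)
Require Import Defs.
From HB Require Import structures.
From mathcomp Require Import all_boot all_order all_algebra.
From mathcomp Require Import all_classical all_reals all_analysis.
From mathcomp Require Import measurable_realfun ring lra zify.
From mathcomp Require mpoly.

(** In fact GAS(f) <= pi (2d+1) sqrt n.  Approximate f = sgn p by smooth
    functions F = h(alpha p + beta) with |h| <= 1 and h' <> 0, and let Y be an
    independent copy of X.
    - Joining X_i to its independent copy by the arc cos t X_i + sin t Y_i, whose
      position and velocity are again independent standard Gaussians, gives
      E|F(X) - F(X^(i))| <= (pi/2) E|d_i F(X)| E|Y_i|.
    - By Cauchy-Schwarz, sum_i |d_i F| E|Y_i| <= sqrt n |grad F| E|Y_1|, and the
      last two factors equal E_Y |<grad F(X), Y>| because <a, Y> has the law of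
      |a| Y_1.
    - <grad F(X), Y> is the derivative at t = 0 of F(cos t X + sin t Y), so by
      rotation invariance its mean absolute value is at most the mean variation
      of F along the unit arc from X.  With u = tan (t/2), p restricted to the
      circle is a rational function of u having boundedly many critical points,
      so that F has boundedly many monotone pieces there, each of variation at
      most 2, uniformly in alpha and beta. *)

Set Implicit Arguments.
Unset Strict Implicit.
Unset Printing Implicit Defensive.

Import Order.TTheory GRing.Theory Num.Theory.
Import numFieldNormedType.Exports.
Local Open Scope classical_set_scope.
Local Open Scope ring_scope.

(** * Rotation invariance of the planar Gaussian *)

Section planar_gauss.
Context {R : realType}.
Local Notation leb := (@lebesgue_measure R).
Local Notation gam := (normal_prob (0 : R) 1).
Local Notation phi := (normal_pdf (0 : R) 1).

(** Lebesgue measure is the unique measure giving half-open intervals their length, and a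
    translation does not change lengths. *)
Lemma lebesgue_measure_shift (t : R) (A : set R) : measurable A ->
  pushforward leb ((fun x : R => x + t) : _ -> measurableTypeR R) A = leb A.
Proof.
move=> mA; apply/esym/lebesgue_measure_unique => //=.
  exact: measurable_funD.
move=> mt _ [[a b] _ <-].
rewrite /pushforward.
have -> : (fun x : R => x + t) @^-1` `]a, b] = `]a - t, b - t]%classic.
  by apply/seteqP; split => x /=; rewrite !in_itv/= ltrBlDr lerBrDr.
rewrite !lebesgue_measure_itv/= !lte_fin ltrD2r.
by case: ifP => // _; rewrite -!EFinD; congr (_%:E); ring.
Qed.

Lemma integral_shift (t : R) (f : R -> \bar R) : measurable_fun setT f ->
  (forall x, 0 <= f x)%E -> (\int[leb]_x f (x + t)%R = \int[leb]_x f x)%E.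
Proof.
move=> mf f0.
pose g : measurableTypeR R -> measurableTypeR R := fun x => x + t.
have mg : measurable_fun setT g by exact: measurable_funD.
transitivity (\int[pushforward leb g]_x f x)%E.
  by rewrite ge0_integral_pushforward.
apply: eq_measure_integral => A mA _; exact: lebesgue_measure_shift.
Qed.

(** The Radon-Nikodym derivative of the Gaussian law and the explicit density [phi] have the same
    integral over every measurable set, so they agree almost everywhere and one may replace the
    other under the integral. *)
Lemma integral_gauss (f : R -> \bar R) : measurable_fun setT f ->
  (forall x, 0 <= f x)%E ->
  (\int[gam]_x f x = \int[leb]_x (f x * (phi x)%:E))%E.
Proof.
move=> mf f0.
have dom : gam `<< leb := normal_prob_dominates 0 1.
rewrite -(Radon_Nikodym_SigmaFinite.change_of_variables dom)//=.
have mphi : measurable_fun setT (EFin \o phi).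
  by apply/measurable_EFinP; exact: measurable_normal_pdf.
apply: ae_eq_integral => //.
- apply: emeasurable_funM => //; apply: (measurable_int leb).
  exact: Radon_Nikodym_SigmaFinite.f_integrable.
- exact: emeasurable_funM.
- apply: ae_eqe_mul2l.
  apply: integral_ae_eq => //=.
  + exact: Radon_Nikodym_SigmaFinite.f_integrable.
  + by move=> E _ mE; rewrite -Radon_Nikodym_SigmaFinite.f_integral.
Qed.

(* The rotation is a product of three shears, horizontal by s / (1 + c), vertical
   by - s, and horizontal again; each shear is a translation in one variable. *)
Lemma lebesgue_rotation (c s : R) (K : R * R -> \bar R) :
  -1 < c -> c ^+ 2 + s ^+ 2 = 1 ->
  measurable_fun setT K -> (forall z, 0 <= K z)%E ->
  (\int[leb]_x \int[leb]_y K (c * x + s * y, - s * x + c * y)%R =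
   \int[leb]_x \int[leb]_y K (x, y))%E.
Proof.
move=> c1 cs1 mK K0.
have swap (H : R * R -> \bar R) : measurable_fun setT H ->
    (forall z, 0 <= H z)%E ->
    (\int[leb]_x \int[leb]_y H (x, y) = \int[leb]_y \int[leb]_x H (x, y))%E.
  move=> mH H0; exact: (@fubini_tonelli _ _ (measurableTypeR R) (measurableTypeR R) R leb leb H mH H0).
have shl a (H : R * R -> \bar R) : measurable_fun setT H ->
    (forall z, 0 <= H z)%E ->
    (\int[leb]_x \int[leb]_y H (x + a * y, y)%R =
     \int[leb]_x \int[leb]_y H (x, y))%E.
  move=> mH H0.
  have ma : measurable_fun [set: R * R] (fun z => (z.1 + a * z.2, z.2)).
    by apply: measurable_fun_pair => //; apply: measurable_funD => //;
      exact: measurable_funM.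
  rewrite (swap (fun z => H (z.1 + a * z.2, z.2)))//; last first.
    exact: (measurableT_comp mH ma).
  rewrite [RHS](swap H)//; apply: eq_integral => y _ /=.
  rewrite (integral_shift (a * y) (f := fun x => H (x, y)))//.
  exact: measurable_fun_pair1.
have shr a (H : R * R -> \bar R) : measurable_fun setT H ->
    (forall z, 0 <= H z)%E ->
    (\int[leb]_x \int[leb]_y H (x, y + a * x)%R =
     \int[leb]_x \int[leb]_y H (x, y))%E.
  move=> mH H0; apply: eq_integral => x _ /=.
  rewrite (integral_shift (a * x) (f := fun y => H (x, y)))//.
  exact: measurable_fun_pair2.
set a := s / (1 + c).
have c10 : 1 + c != 0 by rewrite gt_eqF// -ltrBlDl sub0r.
have ml : measurable_fun [set: R * R] (fun z => (z.1 + a * z.2, z.2)).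
  by apply: measurable_fun_pair => //; apply: measurable_funD => //;
    exact: measurable_funM.
have mr : measurable_fun [set: R * R] (fun z => (z.1, z.2 + (- s) * z.1)).
  by apply: measurable_fun_pair => //; apply: measurable_funD => //;
    exact: measurable_funM.
rewrite -[RHS](shl a)//.
rewrite -[RHS](shr (- s) (fun z => K (z.1 + a * z.2, z.2)))//; last first.
  exact: (measurableT_comp mK ml).
rewrite -[RHS](shl a (fun z => K (z.1 + a * (z.2 + - s * z.1), z.2 + - s * z.1)))//; last first.
  by apply: (measurableT_comp mK); exact: (measurableT_comp ml mr).
(* It remains to check that the three shears compose to the rotation; [s * s = (1 + c) * (1 - c)]
   turns [s * s / (1 + c)] into [1 - c]. *)
apply: eq_integral => x _; apply: eq_integral => y _ /=; congr (K (_, _)).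
  have -> : c * x + s * y = x * (1 - s * s / (1 + c)) + y * s.
    have -> : s * s = (1 + c) * (1 - c) by rewrite -expr2; move: cs1; lra.
    by field.
  rewrite /a.
  have -> : x + s / (1 + c) * y + s / (1 + c) * (y + - s * (x + s / (1 + c) * y))
    = x * (1 - s * s / (1 + c)) + s / (1 + c) * y * (2 - s * s / (1 + c)) by ring.
  have -> : s * s = (1 + c) * (1 - c) by rewrite -expr2; move: cs1; lra.
  by field.
rewrite /a.
have -> : y + - s * (x + s / (1 + c) * y) = - s * x + y * (1 - s * s / (1 + c)) by ring.
have -> : s * s = (1 + c) * (1 - c) by rewrite -expr2; move: cs1; lra.
by field.
Qed.

Lemma gauss_double_integral (H : R * R -> \bar R) :
  measurable_fun setT H -> (forall z, 0 <= H z)%E ->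
  (\int[gam]_x \int[gam]_y H (x, y) =
   \int[leb]_x \int[leb]_y (H (x, y) * (phi x * phi y)%:E))%E.
Proof.
move=> mH H0.
have mphi : measurable_fun setT (EFin \o phi).
  by apply/measurable_EFinP; exact: measurable_normal_pdf.
have phi0 x : (0 <= (phi x)%:E)%E by rewrite lee_fin normal_pdf_ge0.
rewrite integral_gauss//; last 2 first.
- exact: (measurable_fun_fubini_tonelli_F (m2 := gam) H).
- by move=> x; exact: integral_ge0.
apply: eq_integral => x _.
have mHx : measurable_fun setT (fun y => H (x, y)) by exact: measurable_fun_pair2.
rewrite integral_gauss// -ge0_integralZr//=; last 2 first.
- exact: emeasurable_funM.
- by move=> y _; rewrite mule_ge0.
by apply: eq_integral => y _; rewrite -muleA -EFinM mulrC.
Qed.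

(** The product density depends only on [x ^+ 2 + y ^+ 2], which a rotation preserves, so the claim
    reduces to Lebesgue measure. The bound [-1 < c] comes from the shear factor [s / (1 + c)]. *)
Lemma gauss_rotation (c s : R) (H : R * R -> \bar R) :
  -1 < c -> c ^+ 2 + s ^+ 2 = 1 ->
  measurable_fun setT H -> (forall z, 0 <= H z)%E ->
  (\int[gam]_x \int[gam]_y H (c * x + s * y, - s * x + c * y)%R =
   \int[gam]_x \int[gam]_y H (x, y))%E.
Proof.
move=> c1 cs1 mH H0.
have mrot : measurable_fun [set: R * R]
    (fun z => (c * z.1 + s * z.2, - s * z.1 + c * z.2)).
  by apply: measurable_fun_pair; apply: measurable_funD; exact: measurable_funM.
rewrite (gauss_double_integral (H := fun z => H (c * z.1 + s * z.2, - s * z.1 + c * z.2)))//; last first.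
  exact: (measurableT_comp mH mrot).
rewrite [RHS](gauss_double_integral mH H0).
pose K := (fun z : R * R => H z * (phi z.1 * phi z.2)%:E)%E.
have mK : measurable_fun setT K.
  apply: emeasurable_funM => //; apply/measurable_EFinP.
  by apply: measurable_funM => //; apply: measurableT_comp => //;
    exact: measurable_normal_pdf.
have K0 z : (0 <= K z)%E.
  by rewrite mule_ge0// lee_fin mulr_ge0// normal_pdf_ge0.
apply: etrans (lebesgue_rotation c1 cs1 mK K0).
apply: eq_integral => x _; apply: eq_integral => y _ /=; congr (_ * _%:E)%E.
rewrite !normal_pdfE ?oner_eq0// /normal_fun mulrACA [RHS]mulrACA -!expRD.
congr (_ * expR _); rewrite !subr0 !expr1n -!mulrDl; congr (_ / _).
rewrite -!opprD; congr (- _).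
have -> : (c * x + s * y) ^+ 2 + (- s * x + c * y) ^+ 2 =
  (c ^+ 2 + s ^+ 2) * (x ^+ 2 + y ^+ 2) by ring.
by rewrite cs1 mul1r.
Qed.

End planar_gauss.

(** * Iterated Gaussian integrals *)

Section iterated_integrals.
Context {R : realType}.
Local Notation gam := (normal_prob (0 : R) 1).
Implicit Types (x z : nat -> R) (F G H : (nat -> R) -> \bar R) (s : seq nat).

(* Measurability for the product sigma-algebra on sequences, expressed through
   its universal property. *)
Definition coord_measurable d' (V : measurableType d') (F : (nat -> R) -> V) :=
  forall d (T : measurableType d) (u : T -> nat -> R),
    (forall j, measurable_fun setT (fun t => u t j)) ->
    measurable_fun setT (fun t => F (u t)).

(** The class of integrands to which Tonelli's theorem applies in any set of coordinates; it is
    stable under integrating out a coordinate. *)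
Definition nnmeas F := coord_measurable F /\ forall z, (0 <= F z)%E.

Lemma nnmeas_ge0 F z : nnmeas F -> (0 <= F z)%E.
Proof. by case. Qed.

Lemma nnmeasP F : nnmeas F -> coord_measurable F.
Proof. by case. Qed.

Definition int1 (i : nat) F z : \bar R := (\int[gam]_t F (upd z i t))%E.

(** The head of [s] is the outermost integral; coordinates outside [s] stay as parameters. *)
Definition ints s F := foldr int1 F s.

Lemma ints_cat s1 s2 F : ints (s1 ++ s2) F = ints s1 (ints s2 F).
Proof. by rewrite /ints foldr_cat. Qed.

Lemma upd_measurable d (T : measurableType d) (u : T -> nat -> R) i (v : T -> R) :
  (forall j, measurable_fun setT (fun t => u t j)) -> measurable_fun setT v ->
  forall j, measurable_fun setT (fun t => upd (u t) i (v t) j).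
Proof. by move=> mu mv j; rewrite /upd; case: eqP. Qed.

Lemma nnmeas_upd F x i : nnmeas F -> measurable_fun setT (fun t => F (upd x i t)).
Proof.
by move=> [mF _]; apply: mF => j; apply: upd_measurable => // k; exact: measurable_cst.
Qed.

Lemma nnmeas_int1 i F : nnmeas F -> nnmeas (int1 i F).
Proof.
move=> [mF F0]; split; last by move=> z; exact: integral_ge0.
move=> d T u mu.
apply: (measurable_fun_fubini_tonelli_F (m2 := gam)
  (fun w : T * R => F (upd (u w.1) i w.2))) => //.
apply: mF; apply: upd_measurable => // j.
exact: (measurableT_comp (mu j) measurable_fst).
Qed.

Lemma nnmeas_ints s F : nnmeas F -> nnmeas (ints s F).
Proof. by move=> nF; elim: s => //= i s; exact: nnmeas_int1. Qed.

Lemma updC x i j (t u : R) : i != j -> upd (upd x i t) j u = upd (upd x j u) i t.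
Proof.
move=> ij; apply/funext => k; rewrite /upd.
by have [->|] := eqVneq k j; rewrite ?(negbTE ij)// eq_sym (negbTE ij).
Qed.

Lemma int1C i j F : nnmeas F -> int1 i (int1 j F) = int1 j (int1 i F).
Proof.
move=> [mF F0]; apply/funext => x.
have [->//|ij] := eqVneq i j.
rewrite /int1 (fubini_tonelli (m1 := gam) (m2 := gam)
  (fun w : R * R => F (upd (upd x i w.1) j w.2)))//.
  by apply: eq_integral => u _; apply: eq_integral => t _; rewrite updC.
apply: mF; apply: upd_measurable => //; exact: upd_measurable.
Qed.

Lemma ints_int1C i s F : nnmeas F -> ints s (int1 i F) = int1 i (ints s F).
Proof.
by move=> nF; elim: s => //= j s ->; rewrite int1C//; exact: nnmeas_ints.
Qed.

(* The integral in [gauss_iter] is over the real line with its default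
   measurable structure, while [normal_prob] lives on the Borel structure
   generated by half-open intervals: these have the same measurable sets but
   different displays. *)
Lemma integral_stdnormal (f : R -> \bar R) : measurable_fun setT f ->
  (forall t, 0 <= f t)%E -> (\int[stdnormal]_t f t = \int[gam]_t f t)%E.
Proof.
move=> mf f0.
have mid : measurable_fun [set: measurableTypeR R] (id : measurableTypeR R -> R).
  by [].
exact: (ge0_integral_pushforward mid gam measurableT mf).
Qed.

(** The list is reversed because [gauss_iter] integrates the highest coordinate outermost. *)
Lemma gauss_iterE k F : nnmeas F -> gauss_iter k F = ints (rev (iota 0 k)) F.
Proof.
move=> nF; elim: k => [//|k IH]; apply/funext => x.
have -> : rev (iota 0 k.+1) = k :: rev (iota 0 k).
  by rewrite -addn1 iotaD rev_cat.
rewrite /= IH integral_stdnormal//.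
  exact: (nnmeas_upd _ _ (nnmeas_ints _ nF)).
by move=> t; exact: (nnmeas_ge0 _ (nnmeas_ints _ nF)).
Qed.

Lemma intsC s1 s2 F : nnmeas F -> ints s1 (ints s2 F) = ints s2 (ints s1 F).
Proof.
move=> nF; elim: s1 => //= i s ->; rewrite ints_int1C//; exact: nnmeas_ints.
Qed.

(** Tonelli swaps blocks of integrals, and exchanging adjacent blocks generates all permutations. *)
Lemma ints_perm s1 s2 F : nnmeas F -> perm_eq s1 s2 -> ints s1 F = ints s2 F.
Proof.
move=> nF s12; have := erefl (ints s1 F).
apply: (catCA_perm_ind (P := fun s => ints s1 F = ints s F)) s12 => a b c ->.
by rewrite !ints_cat intsC//; exact: nnmeas_ints.
Qed.

Lemma le_ints s F G x : nnmeas F -> nnmeas G -> (forall z, F z <= G z)%E ->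
  (ints s F x <= ints s G x)%E.
Proof.
move=> nF nG FG; elim: s x => //= i s IH x.
have nFs := nnmeas_ints s nF; have nGs := nnmeas_ints s nG.
apply: ge0_le_integral => //=; first by move=> t _; exact: nnmeas_ge0.
- exact: nnmeas_upd.
- exact: nnmeas_upd.
Qed.

Lemma intsD s F G : nnmeas F -> nnmeas G ->
  ints s (fun z => F z + G z)%E = (fun z => ints s F z + ints s G z)%E.
Proof.
move=> nF nG; elim: s => //= i s ->; apply/funext => x.
have nFs := nnmeas_ints s nF; have nGs := nnmeas_ints s nG.
by rewrite /int1 ge0_integralD//; [move=> t _; exact: nnmeas_ge0|exact: nnmeas_upd
  |move=> t _; exact: nnmeas_ge0|exact: nnmeas_upd].
Qed.

Lemma intsZ s (c : R) F : nnmeas F -> 0 <= c ->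
  ints s (fun z => c%:E * F z)%E = (fun z => c%:E * ints s F z)%E.
Proof.
move=> nF c0; elim: s => //= i s ->; apply/funext => x.
have nFs := nnmeas_ints s nF.
by rewrite /int1 ge0_integralZl//; [exact: nnmeas_upd|move=> t _; exact: nnmeas_ge0].
Qed.

Lemma nnmeas_cst (c : \bar R) : (0 <= c)%E -> nnmeas (fun=> c).
Proof. by split => // d T u _; exact: measurable_cst. Qed.

Lemma nnmeas_sum (I : Type) (r : seq I) (F : I -> (nat -> R) -> \bar R) :
  (forall i, nnmeas (F i)) -> nnmeas (fun z => \sum_(i <- r) F i z)%E.
Proof.
move=> nF; split; last by move=> z; apply: sume_ge0 => i _; exact: nnmeas_ge0.
by move=> d T u mu; apply: emeasurable_sum => i; exact: (nnmeasP (nF i)).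
Qed.

(** Integrating over [s] only visits the points that agree with [x] off [s], so integrands need to
    agree only there. *)
Lemma ints_ext s F G x :
  (forall z, (forall j, j \notin s -> z j = x j) -> F z = G z) ->
  ints s F x = ints s G x.
Proof.
elim: s x => [x FG|i s IH x FG]; first exact: FG.
apply: eq_integral => t _; apply: IH => z zE; apply: FG => j.
rewrite in_cons negb_or => /andP[ji js].
by rewrite zE// /upd (negbTE ji).
Qed.

(** On the fibre through [x] the integrand is constant, and each coordinate carries total mass 1. *)
Lemma ints_frozen s F x :
  (forall z, (forall j, j \notin s -> z j = x j) -> F z = F x) ->
  ints s F x = F x.
Proof.
move=> FE; rewrite (@ints_ext _ _ (fun=> F x))//.
elim: s {FE} => //= i s; set y := F x; clearbody y => IH.
suff -> : ints s (fun=> y) = (fun=> y).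
  by rewrite /int1 integral_cst//= probability_setT mule1.
elim: s {IH} => //= j s ->; apply/funext => z.
by rewrite /int1 integral_cst//= probability_setT mule1.
Qed.

Lemma ints_sum s (I : Type) (r : seq I) (F : I -> (nat -> R) -> \bar R) :
  (forall i, nnmeas (F i)) ->
  ints s (fun z => \sum_(i <- r) F i z)%E =
  (fun z => \sum_(i <- r) ints s (F i) z)%E.
Proof.
move=> nF; elim: r => [|i r IH].
  under eq_fun do rewrite big_nil.
  under [RHS]eq_fun do rewrite big_nil.
  by apply/funext => x; rewrite ints_frozen.
under eq_fun do rewrite big_cons.
under [RHS]eq_fun do rewrite big_cons.
by rewrite intsD ?IH//; exact: nnmeas_sum.
Qed.

Lemma nnmeas_limn_einf (F : nat -> (nat -> R) -> \bar R) :
  (forall m, nnmeas (F m)) -> nnmeas (fun z => limn_einf (fun m => F m z)).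
Proof.
move=> nF; split.
  move=> d T u mu.
  apply: (emeasurable_fun_cvg (fun n t => einfs (fun m => F m (u t)) n)).
    move=> n; apply: (measurable_fun_einfs (f := fun m t => F m (u t))) => m.
    exact: (nnmeasP (nF m)).
  by move=> t _; rewrite limn_einf_lim; exact: is_cvg_einfs.
move=> z; rewrite limn_einf_lim; apply: lime_ge; first exact: is_cvg_einfs.
apply: nearW => n; apply: le_ereal_inf_tmp => _ [k _ <-]; exact: nnmeas_ge0.
Qed.

(** Fatou's lemma applied one coordinate at a time, from the innermost integral outwards. *)
Lemma ints_fatou s (F : nat -> (nat -> R) -> \bar R) x :
  (forall m, nnmeas (F m)) ->
  (ints s (fun z => limn_einf (fun m => F m z)) x
    <= limn_einf (fun m => ints s (F m) x))%E.
Proof.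
move=> nF; elim: s x => //= i s IH x.
have nFs m : nnmeas (ints s (F m)) by exact: nnmeas_ints.
apply: (@le_trans _ _ (int1 i (fun z => limn_einf (fun m => ints s (F m) z)) x)).
  apply: (@le_ints [:: i]) => //.
    by apply: nnmeas_ints; exact: nnmeas_limn_einf.
  exact: nnmeas_limn_einf.
apply: fatou => //.
- by move=> n; exact: nnmeas_upd.
- by move=> n t _; exact: nnmeas_ge0.
Qed.

End iterated_integrals.

(** * Rotations of many coordinate pairs and linear forms in Gaussians *)

Section gaussian_rotations.
Context {R : realType}.
Local Notation gam := (normal_prob (0 : R) 1).
Implicit Types (x z : nat -> R) (F G H : (nat -> R) -> \bar R).

Definition rot2 (c s : R) (i j : nat) z : nat -> R :=
  upd (upd z i (c * z i + s * z j)) j (- s * z i + c * z j).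

Lemma nnmeas_comp (g : (nat -> R) -> nat -> R) F :
  (forall j, coord_measurable (fun z => g z j)) -> nnmeas F ->
  nnmeas (fun z => F (g z)).
Proof.
move=> mg [mF F0]; split=> // d T u mu.
by apply: mF => j; exact: (mg j).
Qed.

Lemma coord_measurable_proj j : coord_measurable (fun z => z j : R).
Proof. by move=> d T u; apply. Qed.

Lemma coord_measurable_lin (a b : R) i j :
  coord_measurable (fun z => a * z i + b * z j).
Proof.
by move=> d T u mu; apply: measurable_funD; apply: measurable_funM.
Qed.

Lemma rot2_measurable c s i j k : coord_measurable (fun z => rot2 c s i j z k).
Proof.
rewrite /rot2 /upd; case: (k == j); first exact: coord_measurable_lin.
by case: (k == i); [exact: coord_measurable_lin|exact: coord_measurable_proj].
Qed.

Lemma ints_rot2 (c s : R) i j H : -1 < c -> c ^+ 2 + s ^+ 2 = 1 -> i != j ->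
  nnmeas H -> ints [:: i; j] (fun z => H (rot2 c s i j z)) = ints [:: i; j] H.
Proof.
move=> c1 cs1 ij nH; apply/funext => x.
pose K (w : R * R) := H (upd (upd x i w.1) j w.2).
have K0 w : (0 <= K w)%E by exact: nnmeas_ge0.
have mK : measurable_fun setT K.
  apply: (nnmeasP nH); apply: upd_measurable => //; exact: upd_measurable.
rewrite /ints /= /int1.
apply: etrans (gauss_rotation c1 cs1 mK K0).
apply: eq_integral => t _; apply: eq_integral => u _.
congr H; apply/funext => k; rewrite /rot2 /upd /= !eqxx (negbTE ij).
by case: (k == j) => //; case: (k == i).
Qed.

Fixpoint pairs (n k : nat) : seq nat :=
  if k is k'.+1 then [:: k', (n + k')%N & pairs n k'] else [::].

(** Coordinates below [n] hold X and coordinates [n] to [2n - 1] hold its independent copy Y. The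
    first [k] pairs (X_l, Y_l) are turned by the same angle; for [k = n] the X part becomes cX +
    sY. *)
Definition rotn (n k : nat) (c s : R) z : nat -> R := fun l =>
  if (l < k)%N then c * z l + s * z (n + l)%N
  else if (n <= l < n + k)%N then - s * z (l - n)%N + c * z l
  else z l.

Lemma rotn_measurable n k c s l : coord_measurable (fun z => rotn n k c s z l).
Proof.
rewrite /rotn; case: (l < k)%N; first exact: coord_measurable_lin.
by case: (n <= l < n + k)%N; [exact: coord_measurable_lin|exact: coord_measurable_proj].
Qed.

Lemma rotnS n k c s z : (k < n)%N ->
  rotn n k.+1 c s z = rot2 c s k (n + k) (rotn n k c s z).
Proof.
move=> kn; apply/funext => l; rewrite /rot2 /upd.
have Ek : rotn n k c s z k = z k.
  by rewrite /rotn ltnn (leqNgt n k) kn.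
have Enk : rotn n k c s z (n + k)%N = z (n + k)%N.
  by rewrite /rotn ltnNge leq_addl/= ltnn andbF.
rewrite Ek Enk; have [->|lnk] := eqVneq l (n + k)%N.
  by rewrite /rotn ltnNge ltn_addr//= leq_addr addnS leqnn/= addKn.
have [->|lk] := eqVneq l k; first by rewrite /rotn leqnn.
by rewrite /rotn addnS !ltnS (leq_eqVlt l k) (negbTE lk)/=
  (leq_eqVlt l (n + k)) (negbTE lnk).
Qed.

(** The rotation factors into planar rotations of disjoint coordinate pairs, and each leaves its own
    double integral unchanged. *)
Lemma ints_rotn (c s : R) n k H : -1 < c -> c ^+ 2 + s ^+ 2 = 1 -> (k <= n)%N ->
  nnmeas H -> ints (pairs n k) (fun z => H (rotn n k c s z)) = ints (pairs n k) H.
Proof.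
move=> c1 cs1; elim: k H => [|k IH] H kn nH.
  apply/funext => x /=; congr H; apply/funext => l.
  by rewrite /rotn addn0 ltn0 ltnNge andbN.
have nHr : nnmeas (fun z => H (rot2 c s k (n + k) z)).
  by apply: nnmeas_comp => // j; exact: rot2_measurable.
under eq_fun do rewrite rotnS//.
rewrite -[pairs n k.+1]/([:: k; (n + k)%N] ++ pairs n k) !ints_cat.
rewrite (IH (fun z => H (rot2 c s k (n + k) z)) (ltnW kn) nHr).
rewrite intsC// ints_rot2//; first by rewrite intsC.
by rewrite neq_ltn ltn_addr.
Qed.

Lemma perm_pairs n k : perm_eq (pairs n k) (iota 0 k ++ iota n k).
Proof.
have cS m j (a : pred nat) : count a (iota m j.+1) = (count a (iota m j) + a (m + j))%N.
  by rewrite -addn1 iotaD count_cat /= addn0.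
apply/permP => a; rewrite count_cat; elim: k => // k IH.
by rewrite !cS /= IH add0n addnACA [RHS]addnC addnA.
Qed.

(** With q the root of [p ^+ 2 + r ^+ 2], the form pt + ru is q times the second coordinate after
    the rotation with cosine [r / q] and sine [- p / q]. The hypothesis [0 <= r] keeps that cosine
    above -1; the case q = 0 is degenerate. *)
Lemma gauss_lincomb2 (psi : R -> \bar R) (b p r : R) :
  measurable_fun setT psi -> (forall t, 0 <= psi t)%E -> 0 <= r ->
  (\int[gam]_t \int[gam]_u psi (b + p * t + r * u)%R =
   \int[gam]_t psi (b + Num.sqrt (p ^+ 2 + r ^+ 2) * t)%R)%E.
Proof.
move=> mpsi psi0 r0.
set q := Num.sqrt _.
have q2 : q ^+ 2 = p ^+ 2 + r ^+ 2 by rewrite sqr_sqrtr// addr_ge0 ?sqr_ge0.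
have q0 : 0 <= q by exact: sqrtr_ge0.
have cstE (y : \bar R) : (\int[gam]_(t in setT) y = y)%E.
  by rewrite integral_cst//= probability_setT mule1.
have [qE|qN] := eqVneq q 0.
  move: q2; rewrite qE expr0n => /esym/eqP.
  rewrite paddr_eq0 ?sqr_ge0// !sqrf_eq0 => /andP[/eqP -> /eqP ->].
  apply: eq_integral => t _; rewrite mul0r addr0.
  under eq_integral do rewrite mul0r addr0.
  by rewrite cstE.
pose H (w : R * R) := psi (b + q * w.2).
have mH : measurable_fun setT H.
  by apply: measurableT_comp => //; apply: measurable_funD => //;
    exact: measurable_funM.
have H0 w : (0 <= H w)%E by exact: psi0.
have c1 : -1 < r / q by rewrite (lt_le_trans (ltrN10 _))// divr_ge0.
have cs1 : (r / q) ^+ 2 + (- p / q) ^+ 2 = 1.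
  by rewrite !expr_div_n sqrrN -mulrDl addrC -q2 divff// sqrf_eq0.
have := gauss_rotation c1 cs1 mH H0.
rewrite /H /= cstE => <-.
apply: eq_integral => t _; apply: eq_integral => u _; congr psi.
by field.
Qed.

(** A linear form in independent standard Gaussians is again Gaussian, with the Euclidean norm of
    its coefficients as standard deviation: the variables are merged one at a time. *)
Lemma ints_lincomb (psi : R -> \bar R) (a : nat -> R) (b : R) s x :
  measurable_fun setT psi -> (forall t, 0 <= psi t)%E -> uniq s ->
  (ints s (fun z => psi (b + \sum_(i <- s) a i * z i)%R) x =
   \int[gam]_t psi (b + Num.sqrt (\sum_(i <- s) a i ^+ 2) * t)%R)%E.
Proof.
move=> mpsi psi0; elim: s b x => [|i s IH] b x.
  move=> _; rewrite /= !big_nil sqrtr0.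
  under eq_integral do rewrite mul0r.
  by rewrite integral_cst//= probability_setT mule1.
move=> /= /andP[iS us]; rewrite /int1 big_cons.
(* The tail sum is written as the square of its root, the coefficient of the single Gaussian that
   the induction hypothesis puts in place of the tail. *)
rewrite -[X in X + _]/(a i ^+ 2) -[X in _ + X](@sqr_sqrtr _ (\sum_(j <- s) a j ^+ 2)); last first.
  by apply: sumr_ge0 => j _; exact: sqr_ge0.
rewrite -gauss_lincomb2 ?sqrtr_ge0//.
apply: eq_integral => t _; rewrite -(IH _ (upd x i t) us).
apply: ints_ext => z zE; congr psi; rewrite big_cons addrA; congr (_ + _ * _ + _).
by rewrite zE// /upd eqxx.
Qed.

End gaussian_rotations.

(** * The Gaussian L1 Poincare inequality on the line *)

Section gauss_variation.
Context {R : realType}.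
Local Notation leb := (@lebesgue_measure R).
Local Notation gam := (normal_prob (0 : R) 1).

Lemma derive_path (g g' : R -> R) (x y t : R) :
  (forall u : R, is_derive u 1 g (g' u)) ->
  is_derive t 1 (fun t => g (cos t * x + sin t * y))
    (g' (cos t * x + sin t * y) * (- sin t * x + cos t * y)).
Proof.
move=> dg.
have dl : is_derive t 1 (fun t => cos t * x + sin t * y) (- sin t * x + cos t * y).
  by apply: is_derive_eq; rewrite /GRing.scale/= !mulr0 !add0r; ring.
exact: (@is_derive1_comp _ g _ t _ _ (dg _) dl).
Qed.

Lemma is_derive_continuous (f f' : R -> R) :
  (forall t : R, is_derive t 1 f (f' t)) -> continuous f.
Proof.
move=> df t; apply: differentiable_continuous; apply/derivable1_diffP.
by have [] := df t.
Qed.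

(** The arc [cos t * x + sin t * y] runs from x at t = 0 to y at t = pi / 2, so the difference is
    the integral of the derivative along it. *)
Lemma path_variation (g g' : R -> R) (x y : R) :
  (forall u : R, is_derive u 1 g (g' u)) -> continuous g' ->
  ((`|g x - g y|%R)%:E <= \int[leb]_(t in `[0%R, (pi / 2)%R])
     (`|g' (cos t * x + sin t * y) * (- sin t * x + cos t * y)|%R)%:E)%E.
Proof.
move=> dg cg'.
pose F t := g (cos t * x + sin t * y).
pose q t := g' (cos t * x + sin t * y) * (- sin t * x + cos t * y).
have dF (t : R) : is_derive t 1 F (q t) by exact: derive_path.
have cq : continuous q.
  move=> t; apply: cvgM.
    apply: (cvg_comp _ g'); last exact: cg'.
    apply: cvgD; apply: cvgMr_tmp; [exact: continuous_cos|exact: continuous_sin].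
  apply: cvgD; apply: cvgMr_tmp; [apply: cvgN; exact: continuous_sin|exact: continuous_cos].
have cF : continuous F := is_derive_continuous dF.
have pi2 : 0 < pi / 2 :> R by rewrite divr_gt0// pi_gt0.
have FTC : (\int[leb]_(t in `[0%R, (pi / 2)%R]) (q t)%:E = (F (pi / 2))%:E - (F 0)%:E)%E.
  apply: continuous_FTC2 => //.
  - exact: continuous_subspaceT.
  - split; first by move=> t _; have [] := dF t.
    + exact/cvg_at_right_filter/cF.
    + exact/cvg_at_left_filter/cF.
  - by move=> t _; rewrite derive1E; have [_ ->] := dF t.
have -> : (`|g x - g y|%R)%:E = `|\int[leb]_(t in `[0%R, (pi / 2)%R]) (q t)%:E|%E.
  by rewrite FTC /F cos_pihalf sin_pihalf cos0 sin0 !mul0r !mul1r addr0 add0r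
    -EFinB abse_EFin distrC.
apply: (le_trans (le_abse_integral _ _ _)) => //.
by apply/measurable_EFinP/measurable_funTS; exact: continuous_measurable_fun.
Qed.

(* The right-hand side is E|g'(X)| E|Y|, kept as a double integral because that
   is what [gauss_rotation] returns at each point of the path. *)
Lemma gauss_L1_poincare (g g' : R -> R) :
  (forall u : R, is_derive u 1 g (g' u)) -> continuous g' ->
  (\int[gam]_x \int[gam]_y (`|g x - g y|%R)%:E <=
   (pi / 2)%:E * \int[gam]_x \int[gam]_y (`|g' x| * `|y|)%R%:E)%E.
Proof.
move=> dg cg'.
set G := (X in (_ <= _ * X)%E).
have pi2 : 0 < pi / 2 :> R by rewrite divr_gt0// pi_gt0.
(* The arc parameter is given the uniform law, a probability measure, for the Tonelli exchanges; the
   normalisation is the source of the factor [pi / 2]. *)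
pose U := uniform_prob pi2.
pose q (t x y : R) := `|g' (cos t * x + sin t * y) * (- sin t * x + cos t * y)|.
have mg : measurable_fun setT g.
  by apply: continuous_measurable_fun; exact: (is_derive_continuous dg).
have mg' : measurable_fun setT g' by exact: continuous_measurable_fun.
have mcos : measurable_fun setT (@cos R).
  by apply: continuous_measurable_fun; exact: continuous_cos.
have msin : measurable_fun setT (@sin R).
  by apply: continuous_measurable_fun; exact: continuous_sin.
have mq d (T : measurableType d) (a b c : T -> R) : measurable_fun setT a ->
    measurable_fun setT b -> measurable_fun setT c ->
    measurable_fun setT (fun w => (q (a w) (b w) (c w))%:E).
  move=> ma mb mc; apply/measurable_EFinP; apply: measurableT_comp => //.
  have mca : measurable_fun setT (cos \o a) by exact: measurableT_comp.
  have msa : measurable_fun setT (sin \o a) by exact: measurableT_comp.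
  apply: measurable_funM.
    apply: measurableT_comp => //; apply: measurable_funD; exact: measurable_funM.
  apply: measurable_funD; apply: measurable_funM => //.
  exact: measurableT_comp.
have q0 t x y : (0 <= (q t x y)%:E)%E by rewrite lee_fin normr_ge0.
have Uq0 x y : (0 <= \int[U]_t (q t x y)%:E)%E by exact: integral_ge0.
have Gq0 t x : (0 <= \int[gam]_y (q t x y)%:E)%E by exact: integral_ge0.
have mU (b c : R) : measurable_fun setT (fun t => (q t b c)%:E) by exact: mq.
have pathU x y : ((`|g x - g y|%R)%:E <= (pi / 2)%:E * \int[U]_t (q t x y)%:E)%E.
  rewrite (integral_uniform pi2 (mU x y) (fun t => q0 t x y)) subr0 muleA -EFinM divff ?gt_eqF// mul1e.
  exact: path_variation.
have mUint d (T : measurableType d) (b c : T -> R) : measurable_fun setT b ->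
    measurable_fun setT c -> measurable_fun setT (fun w => \int[U]_t (q t (b w) (c w))%:E)%E.
  move=> mb mc.
  apply: (measurable_fun_fubini_tonelli_F (m2 := U)
    (fun v : T * R => (q v.2 (b v.1) (c v.1))%:E)) => //.
  by apply: mq => //; apply: measurableT_comp.
apply: (@le_trans _ _ (\int[gam]_x \int[gam]_y ((pi / 2)%:E * \int[U]_t (q t x y)%:E)))%E.
  apply: ge0_le_integral => //.
  - by move=> x _; apply: integral_ge0.
  - apply: (measurable_fun_fubini_tonelli_F (m2 := gam)
      (fun v : R * R => (`|g v.1 - g v.2|%R)%:E)) => //.
    apply/measurable_EFinP; apply: measurableT_comp => //.
    by apply: measurable_funB; apply: measurableT_comp.
  - apply: (measurable_fun_fubini_tonelli_F (m2 := gam)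
      (fun v : R * R => (pi / 2)%:E * \int[U]_t (q t v.1 v.2)%:E)%E) => //.
      by apply: measurable_funeM; exact: mUint.
    by move=> v; rewrite mule_ge0// lee_fin ltW.
  move=> x _; apply: ge0_le_integral => //.
  - apply/measurable_EFinP; apply: measurableT_comp => //.
    by apply: measurable_funB => //.
  - by apply: measurable_funeM; exact: mUint.
(* From here on there is equality: the integral over t is moved outermost, and for each t on the arc
   the inner double integral is [G] by rotation invariance. *)
rewrite le_eqVlt; apply/orP; left; apply/eqP.
have mGU : measurable_fun setT (fun v : R * R => \int[gam]_y (q v.2 v.1 y)%:E)%E.
  apply: (measurable_fun_fubini_tonelli_F (m2 := gam)
    (fun v : (R * R) * R => (q v.1.2 v.1.1 v.2)%:E)%E) => //.
  by apply: mq => //; apply: measurableT_comp.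
have swapU x : (\int[gam]_y \int[U]_t (q t x y)%:E = \int[U]_t \int[gam]_y (q t x y)%:E)%E.
  by apply: (fubini_tonelli (m1 := gam) (m2 := U) (fun v : R * R => (q v.2 x v.1)%:E)) => //;
    exact: mq.
have pull1 x : (\int[gam]_y ((pi / 2)%:E * \int[U]_t (q t x y)%:E) =
    (pi / 2)%:E * \int[U]_t \int[gam]_y (q t x y)%:E)%E.
  rewrite -swapU; apply: ge0_integralZl => //.
  - by apply: (mUint _ (measurableTypeR R) (fun=> x) (fun y => y)).
  - by rewrite lee_fin ltW.
have pull2 : (\int[gam]_x ((pi / 2)%:E * \int[U]_t \int[gam]_y (q t x y)%:E) =
    (pi / 2)%:E * \int[gam]_x \int[U]_t \int[gam]_y (q t x y)%:E)%E.
  apply: ge0_integralZl => //.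
  - exact: (measurable_fun_fubini_tonelli_F (m2 := U)
      (fun v : R * R => \int[gam]_y (q v.2 v.1 y)%:E)%E).
  - by move=> x _; exact: integral_ge0.
  - by rewrite lee_fin ltW.
have swapGU : (\int[gam]_x \int[U]_t \int[gam]_y (q t x y)%:E =
    \int[U]_t \int[gam]_x \int[gam]_y (q t x y)%:E)%E.
  by apply: (fubini_tonelli (m1 := gam) (m2 := U)
    (fun v : R * R => \int[gam]_y (q v.2 v.1 y)%:E)%E) => // v; exact: Gq0.
transitivity (\int[gam]_x ((pi / 2)%:E * \int[U]_t \int[gam]_y (q t x y)%:E))%E.
  by apply: eq_integral => x _; exact: pull1.
suff UG : (\int[U]_t \int[gam]_x \int[gam]_y (q t x y)%:E = G)%E.
  rewrite pull2 swapGU UG; exact: erefl.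
have mH : measurable_fun [set: R * R] (fun v => (`|g' v.1| * `|v.2|)%R%:E).
  apply/measurable_EFinP; apply: measurable_funM; apply: measurableT_comp => //.
  exact: measurableT_comp.
have H0 (v : R * R) : (0 <= (`|g' v.1| * `|v.2|)%R%:E)%E by rewrite lee_fin mulr_ge0.
transitivity (\int[U]_t G)%E; last first.
  by rewrite integral_cst//= probability_setT mule1.
have qE t : -1 < cos t -> (\int[gam]_x \int[gam]_y (q t x y)%:E = G)%E.
  move=> ct; apply: etrans (gauss_rotation ct (cos2Dsin2 t) mH H0).
  by apply: eq_integral => x _; apply: eq_integral => y _; rewrite /q normrM.
have mQ : measurable_fun setT (fun t => \int[gam]_x \int[gam]_y (q t x y)%:E)%E.
  apply: (measurable_fun_fubini_tonelli_F (m2 := gam)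
    (fun v : R * R => \int[gam]_y (q v.1 v.2 y)%:E)%E) => //.
    apply: (measurable_fun_fubini_tonelli_F (m2 := gam)
      (fun v : (R * R) * R => (q v.1.1 v.1.2 v.2)%:E)%E) => //.
    by apply: mq => //; apply: measurableT_comp.
have Q0 t : (0 <= \int[gam]_x \int[gam]_y (q t x y)%:E)%E by exact: integral_ge0.
have G0 : (0 <= G)%E by do 2 apply: integral_ge0 => ? _; exact: H0 (_, _).
(* Rotation invariance is available where [-1 < cos t], which holds on the support of [U]; hence the
   return to Lebesgue measure on that interval. *)
have QG : (\int[leb]_(t in `[0%R, (pi / 2)%R]) \int[gam]_x \int[gam]_y (q t x y)%:E =
    \int[leb]_(t in `[0%R, (pi / 2)%R]) G)%E.
  apply: eq_integral => t; rewrite inE/= in_itv/= => /andP[t0 t1].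
  apply: qE; apply: (lt_le_trans (ltrN10 _)); apply: cos_ge0_pihalf.
  by rewrite t1 andbT (le_trans _ t0)// oppr_le0 ltW.
apply: (etrans (integral_uniform pi2 mQ Q0)); rewrite QG.
exact: (esym (integral_uniform pi2 (@measurable_cst _ _ _ _ _ G) (fun=> G0))).
Qed.

End gauss_variation.

(** * Total variation and critical points *)

Section variation_bound.
Context {R : realType}.
Local Notation TV := total_variation.

Lemma total_variation_monotone (f : R -> R) a b : a <= b ->
  {in `[a, b] &, {homo f : x y / x <= y}} \/
  {in `[a, b] &, {homo f : x y /~ x <= y}} -> TV a b f = (`|f b - f a|)%:E.
Proof.
have aI : a <= b -> a \in `[a, b] by move=> ab; rewrite in_itv/= lexx.
have bI : a <= b -> b \in `[a, b] by move=> ab; rewrite in_itv/= lexx ab.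
move=> ab [nd|ni].
  by rewrite nondecreasing_total_variation// ger0_norm// subr_ge0 nd ?aI ?bI.
have nd : {in `[a, b] &, nondecreasing_fun (\- f)}.
  by move=> x y xI yI xy; rewrite lerN2 ni.
rewrite -total_variationN nondecreasing_total_variation//= opprK.
rewrite ler0_norm; first by rewrite opprB addrC.
by rewrite subr_le0 ni ?aI ?bI.
Qed.

(* Between critical points Rolle's theorem makes f injective, hence monotone. *)
Lemma total_variation_critical (f f' : R -> R) (M : R) (s : seq R) (a b : R) :
  a <= b -> (forall t : R, is_derive t 1 f (f' t)) -> (forall t, `|f t| <= M) ->
  (forall t, a < t < b -> f' t = 0 -> t \in s) ->
  (TV a b f <= (2 * M * (size s).+1%:R)%:E)%E.
Proof.
move=> + df fM.
have M0 : 0 <= M by exact: le_trans (fM 0).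
have osc u v : `|f u - f v| <= 2 * M.
  by rewrite (le_trans (ler_normB _ _))// mulr_natl mulr2n lerD.
pose N a b := count (fun t => a < t < b) s.
(* Induction on a bound for the number of listed points strictly inside the interval. *)
suff H m a' b' : (N a' b' <= m)%N -> a' <= b' ->
    (forall t, a' < t < b' -> f' t = 0 -> t \in s) ->
    (TV a' b' f <= (2 * M * (N a' b').+1%:R)%:E)%E.
  move=> ab fs; apply: (le_trans (H _ _ _ (leqnn _) ab fs)).
  by rewrite lee_fin ler_wpM2l ?mulr_ge0// ler_nat ltnS count_size.
elim: m a' b' => [|m IH] a' b' Nm ab fs.
- rewrite total_variation_monotone//.
    have -> : N a' b' = 0%N by apply/eqP; rewrite -leqn0.
    by rewrite mulr1 lee_fin.
  apply/unstable.strict_monotonicW/itv_continuous_inj_mono.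
    by apply: continuous_subspaceT; exact: (is_derive_continuous df).
  have inj u v : u \in `[a', b'] -> v \in `[a', b'] -> u < v -> f u != f v.
    rewrite !in_itv/= => /andP[au ub] /andP[av vb] uv; apply/eqP => fuv.
    have [||c] := @Rolle R f u v uv _ _ fuv.
    - by move=> t _; have [] := df t.
    - by apply: continuous_subspaceT; exact: (is_derive_continuous df).
    rewrite in_itv/= => /andP[uc cv] [_ d0].
    have cab : a' < c < b' by rewrite (le_lt_trans au)//= (lt_le_trans cv).
    have : c \in s by apply: fs => //; rewrite -d0; have [_ ->] := df c.
    move=> cs; move: Nm; rewrite leqn0 => /eqP N0.
    suff : (0 < N a' b')%N by rewrite N0.
    by rewrite -has_count; apply/hasP; exists c.
  move=> u v uI vI fuv; apply/eqP; case: (ltgtP u v) => // uv.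
    by have := inj _ _ uI vI uv; rewrite fuv eqxx.
  by have := inj _ _ vI uI uv; rewrite fuv eqxx.
have [N0|] := posnP (N a' b').
  by apply: IH => //; rewrite N0.
rewrite -has_count => /hasP[r rs /andP[ar rb]].
(* The cut point [r] is counted in the whole interval but in neither open half, so both halves have
   fewer points and the two bounds add up. *)
have NN : (N a' r + N r b' < N a' b')%N.
  rewrite /N -count_predUI -addn1.
  have -> : count (predI (fun t => a' < t < r) (fun t => r < t < b')) s = 0%N.
    apply/eqP; rewrite -leqn0 leqNgt -has_count; apply/hasP => -[t _ /=].
    by case/andP => /andP[_ tr] /andP[rt _]; move: (lt_trans tr rt); rewrite ltxx.
  rewrite addn0.
  have r1 : (0 < count_mem r s)%N by rewrite -has_count; apply/hasP; exists r => /=.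
  apply: (leq_trans (n := count (predU (fun t => a' < t < r) (fun t => r < t < b')) s + count_mem r s)).
    by rewrite leq_add2l.
  rewrite -count_predUI [X in (_ + X)%N](_ : _ = 0%N) ?addn0.
    apply: sub_count => t /= /orP[/orP[/andP[-> tr]|/andP[rt ->]]|/eqP ->].
    - by rewrite (lt_trans tr).
    - by rewrite (lt_trans ar rt).
    - by rewrite ar.
  apply/eqP; rewrite -leqn0 leqNgt -has_count; apply/hasP => -[t _ /=].
  by case/andP => /orP[/andP[_ tr]|/andP[tr _]] /eqP tE; move: tr; rewrite tE ltxx.
rewrite (total_variationD f (ltW ar) (ltW rb)).
apply: (@le_trans _ _ ((2 * M * (N a' r).+1%:R)%:E + (2 * M * (N r b').+1%:R)%:E)%E).
  apply: leeD; apply: IH.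
  - by rewrite -ltnS (leq_trans _ Nm)// (leq_ltn_trans _ NN)// leq_addr.
  - exact: ltW.
  - by move=> t /andP[at' tr]; apply: fs; rewrite at' (lt_trans tr).
  - by rewrite -ltnS (leq_trans _ Nm)// (leq_ltn_trans _ NN)// leq_addl.
  - exact: ltW.
  - by move=> t /andP[rt tb]; apply: fs; rewrite tb (lt_trans ar).
rewrite -EFinD lee_fin -mulrDr ler_wpM2l ?mulr_ge0// -natrD ler_nat.
by rewrite addSn addnS ltnS.
Qed.

Lemma total_variation_cst (f : R -> R) (a b : R) : a <= b ->
  (forall t : R, is_derive t 1 f 0) -> TV a b f = 0%E.
Proof.
move=> ab df; rewrite nondecreasing_total_variation//.
  by rewrite (is_derive_0_is_cst b a df) subrr.
by move=> x y _ _ _; rewrite (is_derive_0_is_cst x y df).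
Qed.

Lemma sum_le_total_variation (f : R -> R) (t : nat -> R) (N : nat) :
  (forall k, (k < N)%N -> t k <= t k.+1) ->
  ((\sum_(k < N) `|f (t k.+1) - f (t k)|)%:E <= TV (t 0%N) (t N) f)%E.
Proof.
suff: (forall k, (k < N)%N -> t k <= t k.+1) ->
    t 0%N <= t N /\ ((\sum_(k < N) `|f (t k.+1) - f (t k)|)%:E <= TV (t 0%N) (t N) f)%E.
  by move=> H /H[].
elim: N => [|N IH] tS; first by rewrite big_ord0 total_variationxx.
have [|t0N IH1] := IH; first by move=> k kN; apply: tS; exact: ltnW.
have tNS := tS N (ltnSn N).
split; first exact: le_trans tNS.
rewrite big_ord_recr/= EFinD (total_variationD f t0N tNS).
by apply: leeD => //; exact: total_variation_ge.
Qed.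

(** Each root found is split off as a linear factor, which lowers the size by one. *)
Lemma poly_roots_seq (W : {poly R}) : W != 0 ->
  exists2 s : seq R, (size s < size W)%N & forall t, root W t -> t \in s.
Proof.
have [m] := ubnP (size W); elim: m W => // m IH W Wm W0.
have [[r rW]|nr] := pselect (exists r, root W r); last first.
  by exists [::]; [rewrite size_poly_gt0|move=> t tW; case: nr; exists t].
have [Q WQ] := factor_theorem W r rW.
have Q0 : Q != 0 by apply: contra_neq W0 => Q0; rewrite WQ Q0 mul0r.
have sW : size W = (size Q).+1.
  by rewrite WQ size_Mmonic ?monicXsubC// size_XsubC addn2.
have [|//|s sQ sP] := IH Q; first by rewrite -ltnS -sW.
exists (r :: s); first by rewrite sW.
move=> t; rewrite WQ rootM root_XsubC in_cons => /orP[/sP ->|->//].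
by rewrite orbT.
Qed.

(** Since [h'], [alpha] and Q never vanish, the critical points are the roots of the Wronskian P'Q -
    PQ', fewer than [2 * k] in number and independent of [h], [alpha] and [beta]. Each of the at
    most [2 * k] monotone pieces varies by at most 2. *)
Lemma total_variation_rational (h h' : R -> R) (alpha beta a b : R)
    (P Q : {poly R}) k :
  (forall t : R, is_derive t 1 h (h' t)) -> (forall t, h' t != 0) ->
  (forall t, `|h t| <= 1) -> alpha != 0 -> a <= b ->
  (forall t, Q.[t] != 0) -> (size P <= k)%N -> (size Q <= k)%N ->
  (TV a b (fun t => h (alpha * (P.[t] / Q.[t]) + beta))%R <= (4 * k%:R)%:E)%E.
Proof.
move=> dh h'0 h1 al0 ab Q0 sP sQ.
pose W : {poly R} := P^`() * Q - P * Q^`().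
have dg (t : R) : is_derive t 1 (fun t => P.[t] / Q.[t]) (W.[t] / Q.[t] ^+ 2).
  have dV := is_deriveV (Q0 t) (is_derive_poly Q t).
  have := is_deriveM (is_derive_poly P t) dV.
  move=> /(is_derive_eq) H; apply: H.
  rewrite /W !hornerE /GRing.scale/=.
  have := Q0 t; move: (P.[t]) (Q.[t]) (P^`().[t]) (Q^`().[t]) => p q p' q' q0.
  by field.
have dl (t : R) : is_derive t 1 (fun t => alpha * (P.[t] / Q.[t]) + beta)
    (alpha * (W.[t] / Q.[t] ^+ 2)).
  have := is_deriveD (is_deriveZ alpha (dg t)) (is_derive_cst beta t 1).
  by rewrite addr0.
have df (t : R) : is_derive t 1 (fun t => h (alpha * (P.[t] / Q.[t]) + beta))
    (h' (alpha * (P.[t] / Q.[t]) + beta) * (alpha * (W.[t] / Q.[t] ^+ 2))).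
  exact: (@is_derive1_comp _ h _ t _ _ (dh _) (dl _)).
(* A vanishing Wronskian gives no finite list of critical points, but then the composite is
   constant. *)
have [W0|W0] := eqVneq W 0.
  have d0 (t : R) : is_derive t 1 (fun t => h (alpha * (P.[t] / Q.[t]) + beta)) 0.
    by have := df t; rewrite W0 horner0 mul0r !mulr0.
  by rewrite (total_variation_cst ab d0) lee_fin mulr_ge0.
have [s sW sP'] := poly_roots_seq W0.
have sWk : (size W <= 2 * k)%N.
  have sd (p : {poly R}) : (size p <= k)%N -> (size p^`() <= k)%N.
    by apply: leq_trans; exact: leq_trans (size_poly _ _) (leq_pred _).
  have sM (p q : {poly R}) : (size p <= k)%N -> (size q <= k)%N ->
      (size (p * q)%R <= 2 * k)%N.
    move=> sp sq; apply: (leq_trans (size_polyMleq _ _)).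
    by rewrite (leq_trans (leq_pred _))// mul2n -addnn leq_add.
  by rewrite (leq_trans (size_polyD _ _))// geq_max size_polyN !sM// sd.
apply: (le_trans (total_variation_critical (s := s) ab df _ _)).
- by move=> t; exact: h1.
- move=> t _ /eqP; rewrite !mulf_eq0 (negbTE (h'0 _)) (negbTE al0)/= invr_eq0.
  by rewrite expf_eq0/= (negbTE (Q0 t)) orbF => /sP'.
rewrite mulr1 lee_fin (_ : 4 * k%:R = 2 * (2 * k)%:R); last first.
  by rewrite natrM; ring.
by rewrite ler_wpM2l// ler_nat (leq_trans sW).
Qed.

End variation_bound.

(** * Polynomials along curves *)

Section polynomials.
Import (canonicals, coercions) mpoly.
Context {R : realType} (n : nat).
Implicit Types (p q : mpoly.mpoly n R).
Local Notation ev := mpoly.meval.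
Local Notation dm := mpoly.mderiv.

(** Kept as a predicate of the polynomial, so that it can be shown closed under sums and products
    and then follow by induction on [p]. *)
Definition chain_rule p := forall (t : R) (w : R -> 'I_n -> R) (w' : 'I_n -> R),
  (forall i, is_derive t 1 (w ^~ i) (w' i)) ->
  is_derive t 1 (fun t => ev (w t) p) (\sum_i ev (w t) (dm i p) * w' i).

Lemma chain_ruleC c : chain_rule (mpoly.mpolyC n c).
Proof.
move=> t w w' _.
under eq_fun do rewrite mpoly.mevalC.
rewrite big1; first exact: is_derive_cst.
by move=> i _; rewrite mpoly.mderivC mpoly.meval0 mul0r.
Qed.

Lemma chain_ruleXU i : chain_rule (mpoly.mpolyX R (mpoly.mnm1 i)).
Proof.
move=> t w w' dw.
under eq_fun do rewrite mpoly.mevalXU.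
rewrite (bigD1 i)//= big1 ?addr0 => [|j ji]; last first.
  by rewrite mpoly.mderivX mpoly.mnm1E eq_sym (negbTE ji) scale0r mpoly.meval0 mul0r.
have -> : mpoly.mderiv i (mpoly.mpolyX R (mpoly.mnm1 i)) = (1 : mpoly.mpoly n R).
  rewrite mpoly.mderivX mpoly.mnm1E eqxx scale1r -[RHS](@mpoly.mpolyX0 n R).
  by congr mpoly.mpolyX; apply/mpoly.mnmP => j; rewrite mpoly.mnmBE subnn mpoly.mnm0E.
by rewrite mpoly.meval1 mul1r.
Qed.

Lemma chain_ruleD p q : chain_rule p -> chain_rule q -> chain_rule (p + q).
Proof.
move=> cp cq t w w' dw.
under eq_fun do rewrite mpoly.mevalD.
have := is_deriveD (cp t w w' dw) (cq t w w' dw).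
rewrite -big_split/= => H; apply: (is_derive_eq H).
by apply: eq_bigr => i _; rewrite mpoly.mderivD mpoly.mevalD mulrDl.
Qed.

Lemma chain_ruleM p q : chain_rule p -> chain_rule q -> chain_rule (p * q).
Proof.
move=> cp cq t w w' dw.
under eq_fun do rewrite mpoly.mevalM.
have H := is_deriveM (cp t w w' dw) (cq t w w' dw); apply: (is_derive_eq H).
rewrite /GRing.scale/= !mulr_sumr -big_split/=.
apply: eq_bigr => i _; rewrite mpoly.mderivM mpoly.mevalD !mpoly.mevalM; ring.
Qed.

Lemma is_derive_meval p : chain_rule p.
Proof.
elim/mpoly.mpolyind: p => [|c m p _ _ cp]; first by rewrite -mpoly.mpolyC0; exact: chain_ruleC.
apply: chain_ruleD => //; rewrite -mpoly.mul_mpolyC; apply: chain_ruleM; first exact: chain_ruleC.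
rewrite mpoly.mpolyXE_id; apply: big_ind => [||i _].
- by rewrite -mpoly.mpolyC1; exact: chain_ruleC.
- exact: chain_ruleM.
elim: (m i) => [|k IH]; first by rewrite expr0 -mpoly.mpolyC1; exact: chain_ruleC.
by rewrite exprS; apply: chain_ruleM => //; exact: chain_ruleXU.
Qed.

Lemma coord_measurable_meval (g : (nat -> R) -> 'I_n -> R) p :
  (forall i, coord_measurable (g ^~ i)) -> coord_measurable (fun z => ev (g z) p).
Proof.
move=> mg d T u mu.
under eq_fun do rewrite mpoly.mevalE.
apply: measurable_sum => m; apply: measurable_funM; first exact: measurable_cst.
apply: measurable_prod => i _.
by apply: measurable_funX; exact: mg.
Qed.

(* Numerator of cos t x + sin t y in terms of tan (t/2), over the denominator
   1 + tan (t/2)^2. *)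
Definition circ_poly (x y : R) : {poly R} := x *: (1 - 'X^2) + (2 * y) *: 'X.

Lemma size_circ_poly x y : (size (circ_poly x y) <= 3)%N.
Proof.
rewrite (leq_trans (size_polyD _ _))// geq_max.
rewrite !(leq_trans (size_scale_leq _ _))//.
  by rewrite size_polyX.
by rewrite (leq_trans (size_polyD _ _))// geq_max size_polyN size_polyXn size_poly1.
Qed.

Lemma size_exp_leq3 (P : {poly R}) k : (size P <= 3)%N -> (size (P ^+ k)%R <= (2 * k).+1)%N.
Proof.
move=> sP; apply: (leq_trans (size_poly_exp_leq _ _)).
by rewrite ltnS leq_mul2r; apply/orP; right; case: (size P) sP.
Qed.

Lemma size_1X2 : (size ((1 + 'X^2)%R : {poly R}) <= 3)%N.
Proof. by rewrite (leq_trans (size_polyD _ _))// geq_max size_polyXn size_poly1. Qed.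

(** On the circle each variable is a quadratic in t over 1 + t^2. A monomial of degree e is brought
    to the common denominator (1 + t^2)^d by the factor (1 + t^2)^(d - e), which keeps the numerator
    of degree at most 2d. *)
Lemma meval_circle (p : mpoly.mpoly n R) (x y : 'I_n -> R) d : (tdeg p <= d)%N ->
  exists2 P : {poly R}, (size P <= (2 * d).+1)%N &
  forall t, ev (fun i => ((1 - t ^+ 2) / (1 + t ^+ 2)) * x i
      + (2 * t / (1 + t ^+ 2)) * y i) p = P.[t] / ((1 + 'X^2) ^+ d).[t].
Proof.
move=> pd.
exists (\sum_(m <- mpoly.msupp p) mpoly.mcoeff m p *:
  ((1 + 'X^2) ^+ (d - mpoly.mdeg m) * \prod_i circ_poly (x i) (y i) ^+ m i)).
  rewrite big_seq; apply: (big_ind (fun P : {poly R} => (size P <= (2 * d).+1)%N)).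
  - by rewrite size_poly0.
  - by move=> P Q sP sQ; rewrite (leq_trans (size_polyD _ _))// geq_max sP.
  move=> m mp; rewrite (leq_trans (size_scale_leq _ _))//.
  have md : (mpoly.mdeg m <= d)%N.
    by apply: leq_trans pd; rewrite /tdeg (big_rem m)//= leq_maxl.
  have sprod (s : seq 'I_n) : (size (\prod_(i <- s) circ_poly (x i) (y i) ^+ m i)%R
      <= (2 * \sum_(i <- s) m i).+1)%N.
    elim: s => [|i s IH]; first by rewrite !big_nil size_poly1.
    rewrite !big_cons (leq_trans (size_polyMleq _ _))//.
    have := size_exp_leq3 (m i) (size_circ_poly (x i) (y i)).
    by move: IH; move: (size _) (size _); lia.
  apply: (leq_trans (size_polyMleq _ _)).
  have := size_exp_leq3 (d - mpoly.mdeg m) size_1X2.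
  have := sprod (index_enum _); rewrite -mpoly.mdegE.
  by move: md; move: (size _) (size _); lia.
move=> t; rewrite mpoly.mevalE horner_sum mulr_suml [LHS]big_seq [RHS]big_seq.
apply: eq_bigr => m mp.
have D0 : 1 + t ^+ 2 != 0 by rewrite gt_eqF// ltr_pwDl// sqr_ge0.
have md : (mpoly.mdeg m <= d)%N.
  by apply: leq_trans pd; rewrite /tdeg (big_rem m)//= leq_maxl.
rewrite hornerZ -[RHS]mulrA; congr (_ * _).
have XE : (1 + 'X^2 : {poly R}).[t] = 1 + t ^+ 2 by rewrite !hornerE.
have -> : ((1 + 'X^2 : {poly R}) ^+ d).[t] =
    (1 + t ^+ 2) ^+ (d - mpoly.mdeg m) * (1 + t ^+ 2) ^+ mpoly.mdeg m.
  by rewrite horner_exp XE -exprD subnK.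
rewrite hornerM horner_exp horner_prod XE -mulf_div divff ?expf_neq0// mul1r.
rewrite mpoly.mdegE -prodrXr -prodfV -big_split/=.
apply: eq_bigr => i _; rewrite horner_exp -exprVn -exprMn; congr (_ ^+ _).
by rewrite /circ_poly !hornerE; ring.
Qed.

End polynomials.

(** * From resampling to directional derivatives *)

Section step_sum.
Context {R : realType}.
Local Notation gam := (normal_prob (0 : R) 1).

(** Cauchy-Schwarz against the all-ones vector, read off from the nonnegative sum of the squares of
    [n%:R * b i - S]. *)
Lemma sum_norm_le_sqrt n (a : 'I_n -> R) :
  \sum_i `|a i| <= Num.sqrt n%:R * Num.sqrt (\sum_i a i ^+ 2).
Proof.
have S0 : 0 <= \sum_i `|a i| by apply: sumr_ge0.
rewrite -sqrtrM ?ler0n// -[leLHS](ger0_norm S0) -sqrtr_sqr ler_wsqrtr//.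
have -> : \sum_i a i ^+ 2 = \sum_i `|a i| ^+ 2.
  by apply: eq_bigr => i _; rewrite real_normK// num_real.
pose b i := `|a i|; pose S := \sum_i b i; pose Q := \sum_i b i ^+ 2.
suff : 0 <= n%:R * Q - S ^+ 2 by rewrite subr_ge0.
have : 0 <= \sum_i (n%:R * b i - S) ^+ 2 by apply: sumr_ge0 => i _; exact: sqr_ge0.
rewrite (eq_bigr (fun i => n%:R ^+ 2 * b i ^+ 2 - (2 * n%:R * S) * b i + S ^+ 2)); last first.
  by move=> i _; ring.
rewrite big_split/= sumrB -!mulr_sumr -/S -/Q sumr_const card_ord -[S *+ n]mulr_natl.
have -> : n%:R ^+ 2 * Q - 2 * n%:R * S * S + S * (n%:R * S) = n%:R * (n%:R * Q - S ^+ 2).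
  by ring.
(* The factor [n%:R] can be cancelled only when n is positive; for n = 0 all sums are empty. *)
have [n0|n0] := posnP n; last by rewrite pmulr_rge0// ltr0n.
move=> _; rewrite /S /Q; move: (b); rewrite n0 => b'.
by rewrite !big_ord0 mulr0 expr0n subr0.
Qed.

Lemma intsZE s (c : R) (G : (nat -> R) -> \bar R) x : nnmeas G -> 0 <= c ->
  (ints s (fun z => c%:E * G z) x = c%:E * ints s G x)%E.
Proof. by move=> nG c0; rewrite intsZ. Qed.

Lemma big_iota_ord n (f : nat -> R) :
  \sum_(j <- iota n n) f j = \sum_(i < n) f (n + i)%N.
Proof.
have -> : iota n n = map (addn n) (index_iota 0 n).
  by rewrite /index_iota subn0 -iotaDl addn0.
by rewrite big_map big_mkord.
Qed.

(** [F] stands for a smooth function of the coordinates below [n], and [a i] for its partial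
    derivative in coordinate i. Coordinate [n] is the fresh Gaussian used for resampling. *)
Variables (n : nat) (F : (nat -> R) -> R) (a : nat -> (nat -> R) -> R).
Hypothesis mF : coord_measurable F.
Hypothesis ma : forall i, coord_measurable (a i).
Hypothesis F_local : forall z z' : nat -> R, (forall j, (j < n)%N -> z j = z' j) -> F z = F z'.
Hypothesis a_local : forall i (z z' : nat -> R),
  (forall j, (j < n)%N -> z j = z' j) -> a i z = a i z'.
Hypothesis dF : forall i x (t : R), (i < n)%N ->
  is_derive t 1 (fun t => F (upd x i t)) (a i (upd x i t)).
Hypothesis ca : forall i x, (i < n)%N -> continuous (fun t : R => a i (upd x i t)).

Definition resample_diff i z : \bar R := (`|F z - F (upd z i (z n))|)%:E.
Definition resample_grad i z : \bar R := (`|a i z| * `|z n|)%:E.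

Lemma nnmeas_real (f : (nat -> R) -> R) : coord_measurable f ->
  (forall z, 0 <= f z) -> nnmeas (fun z => (f z)%:E).
Proof.
move=> mf f0; split; last by move=> z; rewrite lee_fin.
by move=> d T u mu; apply/measurable_EFinP; exact: mf.
Qed.

Lemma nnmeas_resample_diff i : nnmeas (resample_diff i).
Proof.
apply: (nnmeas_real (f := fun z => `|F z - F (upd z i (z n))|)) => // d T u mu.
apply: measurableT_comp => //; apply: measurable_funB; first exact: mF.
by apply: mF; exact: upd_measurable.
Qed.

Lemma nnmeas_resample_grad i : nnmeas (resample_grad i).
Proof.
apply: (nnmeas_real (f := fun z => `|a i z| * `|z n|)) => [d T u mu|z]; last first.
  exact: mulr_ge0.
by apply: measurable_funM; apply: measurableT_comp => //; exact: ma.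
Qed.

(** The one-dimensional Poincare inequality in coordinate i, with coordinate [n] as the independent
    copy; locality makes [F] and [a i] blind to coordinate [n]. *)
Lemma resample_pair_le i x : (i < n)%N ->
  (ints [:: i; n] (resample_diff i) x <= (pi / 2)%:E * ints [:: i; n] (resample_grad i) x)%E.
Proof.
move=> lin; have ni : (n == i) = false by rewrite gtn_eqF.
have E t s j : (j < n)%N -> upd (upd x i t) n s j = upd x i t j.
  by move=> jn; rewrite /upd ltn_eqF.
have P := @gauss_L1_poincare R (fun t => F (upd x i t)) (fun t => a i (upd x i t))
  (fun t => dF x t lin) (@ca i x lin).
have -> : ints [:: i; n] (resample_diff i) x =
    (\int[gam]_t \int[gam]_s (`|F (upd x i t) - F (upd x i s)|%R)%:E)%E.
  apply: eq_integral => t _; apply: eq_integral => s _; rewrite /resample_diff.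
  congr (`|_ - _|%:E); first exact: F_local (E t s).
  apply: F_local => j jn; rewrite /upd eqxx (ltn_eqF jn).
  by case: (j == i).
have -> : ints [:: i; n] (resample_grad i) x =
    (\int[gam]_t \int[gam]_s (`|a i (upd x i t)| * `|s|)%R%:E)%E.
  apply: eq_integral => t _; apply: eq_integral => s _; rewrite /resample_grad.
  by rewrite (a_local i (E t s)) [X in `|X n|]/upd eqxx.
exact: P.
Qed.

Lemma resample_le i x : (i < n)%N ->
  (ints (iota 0 n.+1) (resample_diff i) x <= (pi / 2)%:E * ints (iota 0 n.+1) (resample_grad i) x)%E.
Proof.
move=> lin.
(* Coordinates i and n are made innermost, so that the inequality for the pair applies under the
   remaining integrals. *)
have ps : perm_eq (iota 0 n.+1) (rem n (rem i (iota 0 n.+1)) ++ [:: i; n]).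
  rewrite perm_sym perm_catC/=.
  have i0 : i \in iota 0 n.+1 by rewrite mem_iota/= add0n ltnW.
  have n0 : n \in rem i (iota 0 n.+1).
    by rewrite mem_rem_uniq ?iota_uniq// inE mem_iota/= add0n ltnSn gtn_eqF.
  rewrite perm_sym (perm_trans (perm_to_rem i0))// perm_cons.
  exact: perm_to_rem.
have nn1 := nnmeas_resample_diff i; have nng := nnmeas_resample_grad i.
rewrite (ints_perm nn1 ps) (ints_perm nng ps) !ints_cat.
have pi0 : 0 <= pi / 2 :> R by rewrite divr_ge0// pi_ge0.
have nn2 := nnmeas_ints [:: i; n] (nnmeas_resample_grad i).
rewrite -(intsZE _ _ nn2 pi0).
apply: le_ints; first exact: nnmeas_ints.
- split; last by move=> z; rewrite mule_ge0// ?lee_fin//; exact: nnmeas_ge0.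
  by move=> d T u mu; apply: measurable_funeM; exact: (nnmeasP nn2).
- by move=> z; exact: resample_pair_le.
Qed.

(** After the Poincare step and Cauchy-Schwarz, the gradient norm times the one fresh Gaussian is
    traded for the inner product of the gradient with a full copy Y, stored in coordinates [n] to
    [2n - 1]. *)
Lemma sum_resample_le (x : nat -> R) :
  (ints (iota 0 n.+1)
      (fun z => \sum_(i < n) (`|F z - F (upd z i (z n))|%R)%:E) x <=
   (pi / 2 * Num.sqrt n%:R)%:E *
     ints (iota 0 n ++ iota n n)
       (fun z => (`|\sum_(i < n) a i z * z (n + i)%N|%R)%:E) x)%E.
Proof.
have pi0 : 0 <= pi / 2 :> R by rewrite divr_ge0// pi_ge0.
pose A z := \sum_(i < n) `|a i z|.
pose L z : \bar R := (`|\sum_(i < n) a i z * z (n + i)%N|%R)%:E.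
have mA : coord_measurable A.
  move=> d T u mu; apply: measurable_sum => i; apply: measurableT_comp => //.
  exact: ma.
have nnL : nnmeas L.
  apply: (nnmeas_real (f := fun z => `|\sum_(i < n) a i z * z (n + i)%N|)) => // d T u mu.
  apply: measurableT_comp => //; apply: measurable_sum => i.
  by apply: measurable_funM => //; exact: ma.
have nnAn : nnmeas (fun z => (A z * `|z n|)%:E).
  apply: (nnmeas_real (f := fun z => A z * `|z n|)) => [d T u mu|z].
    apply: measurable_funM; first exact: mA.
    exact: measurableT_comp.
  by rewrite mulr_ge0// sumr_ge0.
rewrite -[X in ints _ X]/(fun z => \sum_(i < n) resample_diff i z)%E.
rewrite ints_sum; last by move=> i; exact: nnmeas_resample_diff.
apply: (@le_trans _ _ (\sum_(i < n) ((pi / 2)%:E * ints (iota 0 n.+1) (resample_grad i) x)))%E.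
  by apply: lee_sum => i _; exact: resample_le.
rewrite -ge0_sume_distrr; last first.
  by move=> i _; exact: (nnmeas_ge0 _ (nnmeas_ints _ (nnmeas_resample_grad i))).
rewrite (EFinM (pi / 2)) -muleA; apply: lee_wpmul2l; first by rewrite lee_fin.
have -> : (\sum_(i < n) ints (iota 0 n.+1) (resample_grad i) x =
    ints (iota 0 n.+1) (fun z => (A z * `|z n|)%:E) x)%E.
  have <- : (fun z => \sum_(i < n) resample_grad i z)%E = (fun z => (A z * `|z n|)%:E).
    by apply/funext => z; rewrite /A mulr_suml sumEFin.
  by rewrite ints_sum// => i; exact: nnmeas_resample_grad.
(* With coordinate [n] innermost, the comparison is made at fixed X: one Gaussian on the left
   against the n coordinates of Y on the right. *)
have -> : iota 0 n.+1 = iota 0 n ++ [:: n] by rewrite -addn1 iotaD.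
rewrite !ints_cat.
have nn3 := nnmeas_ints (iota n n) nnL.
rewrite -(intsZE _ _ nn3 (sqrtr_ge0 _)).
apply: le_ints; first exact: nnmeas_ints.
  split; last by move=> z; rewrite mule_ge0// ?lee_fin ?sqrtr_ge0//; exact: nnmeas_ge0.
  by move=> d T u mu; apply: measurable_funeM; exact: (nnmeasP nn3).
move=> z.
pose psi (t : R) : \bar R := (`|t|)%:E.
have mpsi : measurable_fun setT psi.
  by apply/measurable_EFinP; exact: normr_measurable.
have psi0 t : (0 <= psi t)%E by rewrite /psi lee_fin.
(* At fixed X the gradient is a constant vector, so its inner product with Y has the law of its norm
   times one Gaussian. *)
have LE : ints (iota n n) L z = (\int[gam]_t psi (0 + Num.sqrt (\sum_(i < n) a i z ^+ 2) * t)%R)%E.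
  have -> : \sum_(i < n) a i z ^+ 2 = \sum_(j <- iota n n) (a (j - n)%N z) ^+ 2.
    by rewrite big_iota_ord; apply: eq_bigr => i _; rewrite addKn.
  rewrite -(ints_lincomb (fun j => a (j - n)%N z) 0 z mpsi psi0 (iota_uniq _ _)).
  apply: ints_ext => w wE; rewrite /L /psi add0r big_iota_ord.
  congr (`|_|%:E); apply: eq_bigr => i _; rewrite addKn; congr (_ * _).
  apply: a_local => j jn; apply: wE; by rewrite mem_iota negb_and -ltnNge jn.
rewrite LE /ints/= /int1.
have mabs : measurable_fun setT (fun t : R => (`|t|)%:E) by [].
have mps : measurable_fun setT
    (fun t => psi (0 + Num.sqrt (\sum_(i < n) a i z ^+ 2) * t)).
  by apply: (measurableT_comp mpsi); apply: measurable_funD => //; apply: measurable_funM.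
have sn0 : (0 <= (Num.sqrt n%:R : R)%:E)%E by rewrite lee_fin sqrtr_ge0.
rewrite -ge0_integralZl//.
apply: ge0_le_integral => //.
- by move=> t _; rewrite lee_fin mulr_ge0// sumr_ge0.
- exact: nnmeas_upd nnAn.
- exact: measurable_funeM.
- move=> t _; rewrite /psi add0r -EFinM lee_fin normrM mulrA.
  have -> : A (upd z n t) = A z.
    apply: eq_bigr => i _; congr `|_|; apply: a_local => j jn.
    by rewrite /upd ltn_eqF.
  rewrite /upd eqxx ler_wpM2r// (ger0_norm (sqrtr_ge0 _)).
  exact: sum_norm_le_sqrt.
Qed.

End step_sum.

(** * Smooth approximation of the threshold function *)

Section sigmoid.
Context {R : realType}.

(** Chosen because it stays within [-1, 1], tends to the two signs at infinity, and has a derivative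
    without zeros, so it adds no critical points. *)
Definition sigmoid (x : R) : R := 2 / pi * atan x.
Definition sigmoid' (x : R) : R := 2 / pi * (1 + x ^+ 2)^-1.

Lemma two_div_pi_gt0 : 0 < 2 / pi :> R.
Proof. by rewrite divr_gt0// pi_gt0. Qed.

Lemma is_derive_sigmoid (x : R) : is_derive x 1 sigmoid (sigmoid' x).
Proof.
have da : is_derive x 1 (@atan R) (1 + x ^+ 2)^-1.
  by apply: DeriveDef; [exact: derivable_atan|rewrite -derive1E derive1_atan].
exact: (is_deriveZ (2 / pi) da).
Qed.

Lemma sigmoid'_neq0 x : sigmoid' x != 0.
Proof.
apply: mulf_neq0; first by rewrite gt_eqF// two_div_pi_gt0.
by rewrite invr_neq0// gt_eqF// ltr_pwDl// sqr_ge0.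
Qed.

Lemma continuous_sigmoid' : continuous sigmoid'.
Proof.
move=> x; apply: (@continuousM _ _ (fun=> 2 / pi) (fun y : R => (1 + y ^+ 2)^-1)).
  exact: cst_continuous.
apply: (@continuousV _ _ (fun y : R => 1 + y ^+ 2) x).
  by rewrite gt_eqF// ltr_pwDl// sqr_ge0.
by apply: cvgD; [exact: cvg_cst|exact: exprn_continuous].
Qed.

Lemma sigmoid_norm x : `|sigmoid x| <= 1.
Proof.
rewrite normrM (ger0_norm (ltW two_div_pi_gt0)) mulrC -ler_pdivlMr ?two_div_pi_gt0//.
rewrite div1r invf_div ler_norml.
by rewrite !ltW ?atan_gtNpi2 ?atan_ltpi2.
Qed.

Lemma cvg_sigmoid (u : nat -> R) : u n @[n --> \oo] --> +oo ->
  sigmoid (u n) @[n --> \oo] --> (1 : R).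
Proof.
move=> uy.
rewrite [X in _ --> X](_ : 1 = 2 / pi * (pi / 2)); last first.
  by rewrite mulrA divfK ?gt_eqF ?pi_gt0// divff.
apply: cvgMl_tmp; apply: (cvg_comp u (@atan R)); [exact: uy|exact: cvgy_atan].
Qed.

Lemma sigmoidN x : sigmoid (- x) = - sigmoid x.
Proof. by rewrite /sigmoid atanN mulrN. Qed.

(* The shift by m forces the limit 1 = sgn 0 on the zero set. *)
Lemma cvg_sigmoid_sgn (y : R) :
  sigmoid (m.+1%:R ^+ 2 * y + m.+1%:R) @[m --> \oo] --> sgn y.
Proof.
have cS : (m.+1%:R : R) @[m --> \oo] --> +oo.
  by rewrite (cvg_shiftS (fun m => m%:R : R)); exact: cvgr_idn.
rewrite /sgn; case: ifPn => [y0|].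
  apply: cvg_sigmoid; apply: ger_cvgy cS.
  by apply: nearW => m; rewrite lerDr mulr_ge0// sqr_ge0.
rewrite -ltNge => y0.
under eq_fun do rewrite -[X in sigmoid X]opprK sigmoidN.
apply: cvgN; apply: cvg_sigmoid; apply: ger_cvgy cS.
exists (Num.truncn (2 / - y)) => // m /= mM.
have my : 2 <= m.+1%:R * - y.
  rewrite -ler_pdivrMr ?oppr_gt0// (le_trans (ltW (truncnS_gt _)))//.
  by rewrite ler_nat ltnS.
have -> : - (m.+1%:R ^+ 2 * y + m.+1%:R) = m.+1%:R * (m.+1%:R * - y) - m.+1%:R by ring.
by rewrite lerBrDr (_ : _ + _ = m.+1%:R * 2) ?ler_wpM2l//; ring.
Qed.

(** Caratheodory's form of the derivative turns the difference quotient into the value of a function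
    continuous at [a]. *)
Lemma derive_seq (f : R -> R) (a d : R) : is_derive a 1 f d ->
  N.+1%:R * (f (a + N.+1%:R^-1) - f a) @[N --> \oo] --> d.
Proof.
move=> /is_derive1_caratheodory [g [fE cg <-]].
rewrite (_ : (fun N => _) = (fun N => g (a + N.+1%:R^-1))); last first.
  by apply/funext => N; rewrite fE addrAC subrr add0r mulrCA mulfV ?mulr1.
have ca : a + N.+1%:R^-1 @[N --> \oo] --> a.
  rewrite -[X in _ --> X]addr0; apply: cvgD; first exact: cvg_cst.
  exact: cvg_harmonic.
by apply: (cvg_comp (fun N => a + N.+1%:R^-1) g); [exact: ca|exact: cg].
Qed.

End sigmoid.

(** * Smoothed threshold functions and their gradients *)

Section smooth_threshold.
Context {R : realType} (n : nat) (p : mpoly.mpoly n R) (alpha beta : R).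
Local Notation ev := mpoly.meval.
Local Notation dm := mpoly.mderiv.
Implicit Types (z x : nat -> R).

Definition peval (q : mpoly.mpoly n R) z : R := ev (fun j : 'I_n => z j) q.

Definition smooth_ptf z : R := sigmoid (alpha * peval p z + beta).

(** The partial derivative of [smooth_ptf] in coordinate i, indexed by all naturals; indices from
    [n] on get the default 0. *)
Definition smooth_grad (i : nat) z : R :=
  sigmoid' (alpha * peval p z + beta) *
  (alpha * oapp (fun k : 'I_n => peval (dm k p) z) 0 (insub i)).

Lemma coord_measurable_peval q : coord_measurable (peval q).
Proof.
apply: coord_measurable_meval => i; exact: coord_measurable_proj.
Qed.

Lemma coord_measurable_comp (g : R -> R) (f : (nat -> R) -> R) :
  measurable_fun setT g -> coord_measurable f -> coord_measurable (fun z => g (f z)).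
Proof. by move=> mg mf d T u mu; apply: measurableT_comp => //; exact: mf. Qed.

Lemma coord_measurable_affine : coord_measurable (fun z => alpha * peval p z + beta).
Proof.
move=> d T u mu; apply: measurable_funD => //; apply: measurable_funM => //.
exact: coord_measurable_peval.
Qed.

Lemma coord_measurable_smooth_ptf : coord_measurable smooth_ptf.
Proof.
apply: (coord_measurable_comp (g := sigmoid)); last exact: coord_measurable_affine.
by apply: continuous_measurable_fun; apply: is_derive_continuous; exact: is_derive_sigmoid.
Qed.

Lemma coord_measurable_smooth_grad i : coord_measurable (smooth_grad i).
Proof.
move=> d T u mu; apply: measurable_funM.
  apply: (coord_measurable_comp (g := sigmoid') _ coord_measurable_affine mu).
  by apply: continuous_measurable_fun; exact: continuous_sigmoid'.
apply: measurable_funM => //; case: insub => //= k.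
exact: coord_measurable_peval.
Qed.

Lemma peval_local q z z' : (forall j, (j < n)%N -> z j = z' j) -> peval q z = peval q z'.
Proof. by move=> zz; apply: mpoly.meval_eq => j; apply: zz. Qed.

Lemma smooth_ptf_local z z' : (forall j, (j < n)%N -> z j = z' j) -> smooth_ptf z = smooth_ptf z'.
Proof. by move=> zz; rewrite /smooth_ptf (peval_local _ zz). Qed.

Lemma smooth_grad_local i z z' : (forall j, (j < n)%N -> z j = z' j) ->
  smooth_grad i z = smooth_grad i z'.
Proof.
move=> zz; rewrite /smooth_grad (peval_local _ zz); case: insub => //= k.
by rewrite (peval_local _ zz).
Qed.

Lemma is_derive_peval_upd q i x (t : R) (lin : (i < n)%N) :
  is_derive t 1 (fun t => peval q (upd x i t)) (peval (dm (Ordinal lin) q) (upd x i t)).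
Proof.
have := @is_derive_meval R n q t (fun t (j : 'I_n) => upd x i t j)
  (fun j => (j == i :> nat)%:R).
have dw (j : 'I_n) : is_derive t 1 (fun t : R => upd x i t j) (j == i :> nat)%:R.
  rewrite /upd; case: (j == i :> nat); first exact: is_derive_id.
  exact: is_derive_cst.
move=> /(_ dw); rewrite (bigD1 (Ordinal lin))//= eqxx mulr1 big1 ?addr0// => j.
by rewrite -val_eqE /= => /negbTE ->; rewrite mulr0.
Qed.

Lemma is_derive_smooth_ptf_upd i x (t : R) : (i < n)%N ->
  is_derive t 1 (fun t => smooth_ptf (upd x i t)) (smooth_grad i (upd x i t)).
Proof.
move=> lin; rewrite /smooth_grad insubT/=.
apply: (@is_derive1_comp _ sigmoid _ t _ _ (is_derive_sigmoid _)).
have := is_deriveD (is_deriveZ alpha (is_derive_peval_upd p x t lin)) (is_derive_cst beta t 1).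
by rewrite addr0.
Qed.

Lemma continuous_smooth_grad_upd i x : (i < n)%N ->
  continuous (fun t : R => smooth_grad i (upd x i t)).
Proof.
move=> lin; rewrite /smooth_grad insubT/= => t.
have cev q : continuous (fun t : R => peval q (upd x i t)).
  by apply: is_derive_continuous => u; exact: is_derive_peval_upd.
apply: cvgM; last by apply: cvgMl_tmp; exact: cev.
apply: (cvg_comp _ sigmoid'); last exact: continuous_sigmoid'.
by apply: cvgD; [apply: cvgMl_tmp; exact: cev|exact: cvg_cst].
Qed.

Lemma smooth_ptf_rotn (c s : R) z : smooth_ptf (rotn n n c s z) =
  sigmoid (alpha * ev (fun i : 'I_n => c * z i + s * z (n + i)%N) p + beta).
Proof.
congr (sigmoid (_ * _ + _)); apply: mpoly.meval_eq => i.
by rewrite /rotn ltn_ord.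
Qed.

(** At t = 0 the curve cos t X + sin t Y passes through X with velocity Y. *)
Lemma is_derive_smooth_ptf_rot z :
  is_derive (0 : R) 1 (fun t => smooth_ptf (rotn n n (cos t) (sin t) z))
    (\sum_(i < n) smooth_grad i z * z (n + i)%N).
Proof.
have dw (i : 'I_n) : is_derive (0 : R) 1 (fun t => cos t * z i + sin t * z (n + i)%N) (z (n + i)%N).
  by apply: is_derive_eq; rewrite /GRing.scale/= sin0 cos0 !mulr0 !add0r; ring.
have dev := @is_derive_meval R n p 0 (fun t (i : 'I_n) => cos t * z i + sin t * z (n + i)%N) _ dw.
have dl := is_deriveD (is_deriveZ alpha dev) (is_derive_cst beta (0 : R) 1).
have ds := @is_derive1_comp _ sigmoid _ 0 _ _ (is_derive_sigmoid _) dl.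
under eq_fun do rewrite smooth_ptf_rotn.
apply: (is_derive_eq ds).
rewrite addr0 /GRing.scale/= !mulr_sumr; apply: eq_bigr => i _.
have evE q : ev (fun i : 'I_n => cos 0 * z i + sin 0 * z (n + i)%N) q = peval q z.
  by apply: mpoly.meval_eq => j; rewrite cos0 sin0 mul1r mul0r addr0.
rewrite /smooth_grad valK/= -[peval p z]evE -[peval (dm i p) z]evE.
by rewrite !mulrA.
Qed.

End smooth_threshold.

Lemma limn_einf_le_cst (R : realType) (u : nat -> \bar R) (c : \bar R) :
  (forall N, u N <= c)%E -> (limn_einf u <= c)%E.
Proof.
move=> uc; rewrite limn_einf_lim; apply: lime_le; first exact: is_cvg_einfs.
apply: nearW => N; apply: le_trans (uc N).
by apply: ereal_inf_lbound; exists N => /=.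
Qed.

(** * Mean variation along the rotation arc *)

Section rotation_average.
Context {R : realType} (n : nat) (p : mpoly.mpoly n R) (alpha beta : R).
Local Notation F := (smooth_ptf p alpha beta).
Local Notation rot t := (rotn n n (cos t) (sin t)).

Lemma tan_half (u : R) : cos (u / 2) != 0 ->
  cos u = (1 - tan (u / 2) ^+ 2) / (1 + tan (u / 2) ^+ 2) /\
  sin u = 2 * tan (u / 2) / (1 + tan (u / 2) ^+ 2).
Proof.
move=> c0; have uE : u = (u / 2) *+ 2 by rewrite -mulr_natr divfK.
have cs := cos2Dsin2 (u / 2).
have -> : cos u = cos (u / 2) ^+ 2 *+ 2 - 1 by rewrite {1}uE cos_mulr2n.
have -> : sin u = (cos (u / 2) * sin (u / 2)) *+ 2 by rewrite {1}uE sin_mulr2n.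
rewrite -cos2_tan2// invrK /tan; move: cs c0.
move: (cos _) (sin _) => c s cs c0.
split; last by field.
rewrite mulrBl mul1r expr_div_n divfK ?expf_neq0//.
by have -> : s ^+ 2 = 1 - c ^+ 2; [rewrite -cs addrAC subrr add0r|ring].
Qed.

Lemma half_angle_itv (u : R) : 0 <= u <= 1 -> u / 2 \in `](- (pi / 2)), (pi / 2)[.
Proof.
move=> /andP[u0 u1]; have p2 := @pihalf_ge1 R; rewrite in_itv/=; apply/andP; split; lra.
Qed.

Lemma cos_unit_ge0 (u : R) : 0 <= u <= 1 -> 0 <= cos u.
Proof.
move=> /andP[u0 u1]; have p2 := @pihalf_ge1 R.
by apply: cos_ge0_pihalf; apply/andP; split; lra.
Qed.

(** In the parameter [tan (th k / 2)], increasing on the unit arc since half angles stay below pi /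
    2, the function is a sigmoid of a rational function with numerator and denominator of size at
    most [(2 * d).+1]. The increments are bounded by its total variation, whatever N. *)
Lemma rot_variation_le d N z : (tdeg p <= d)%N -> alpha != 0 ->
  \sum_(k < N.+1) `|F (rot (k.+1%:R / N.+1%:R) z) - F (rot (k%:R / N.+1%:R) z)|
    <= 4 * (2 * d).+1%:R.
Proof.
move=> pd al0.
have [P sP PE] := meval_circle (fun i => z i) (fun i : 'I_n => z (n + i)%N) pd.
pose Q : {poly R} := (1 + 'X^2) ^+ d.
have Q0 t : Q.[t] != 0.
  by rewrite horner_exp expf_neq0// !hornerE gt_eqF// ltr_pwDl// sqr_ge0.
have sQ : (size Q <= (2 * d).+1)%N by apply: size_exp_leq3; exact: size_1X2.
pose G t := sigmoid (alpha * (P.[t] / Q.[t]) + beta).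
pose th k : R := k%:R / N.+1%:R.
have th01 k : (k <= N.+1)%N -> 0 <= th k <= 1.
  by move=> kN; rewrite /th divr_ge0//= ler_pdivrMr// mul1r ler_nat.
pose t k := tan (th k / 2).
have FG k : (k <= N.+1)%N -> F (rot (th k) z) = G (t k).
  move=> kN; rewrite smooth_ptf_rotn /G -PE.
  have c0 : cos (th k / 2) != 0.
    rewrite gt_eqF//; apply: cos_gt0_pihalf.
    by have := half_angle_itv (th01 k kN); rewrite in_itv.
  by have [-> ->] := tan_half c0.
have tS k : (k < N.+1)%N -> t k <= t k.+1.
  move=> kN; rewrite le_eqVlt; apply/orP; right.
  rewrite ltr_tan; last 2 first.
  - by apply: half_angle_itv; apply: th01; exact: ltnW.
  - by apply: half_angle_itv; exact: th01.
  by rewrite ltr_pM2r// /th ltr_pM2r ?invr_gt0// ltr_nat.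
have tN : t 0%N <= t N.+1.
  suff H k : (k <= N.+1)%N -> t 0%N <= t k by exact: H.
  by elim: k => // k IH kN; rewrite (le_trans (IH (ltnW kN)))// tS.
have TVG := total_variation_rational beta is_derive_sigmoid sigmoid'_neq0 sigmoid_norm al0 tN Q0 sP sQ.
rewrite -lee_fin (le_trans _ TVG)//.
apply: (le_trans _ (sum_le_total_variation G tS)).
rewrite lee_fin le_eqVlt; apply/orP; left; apply/eqP.
by apply: eq_bigr => k _; rewrite -!FG// ltnW.
Qed.

Lemma rotn_rotn (u v : R) z : F (rot u (rot v z)) = F (rot (v + u) z).
Proof.
apply: smooth_ptf_local => j jn; rewrite /rotn jn.
have -> : (n + j < n)%N = false by rewrite ltnNge leq_addr.
rewrite leq_addr ltn_add2l jn addKn/= cosD sinD; ring.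
Qed.

(** The derivative at the start of the arc is N + 1 times a first small increment, up to a limit. By
    rotation invariance all N + 1 increments of the unit arc have the same mean size, so N + 1 times
    that mean is the mean of their sum. *)
Lemma directional_derivative_le d (s : seq nat) x : (tdeg p <= d)%N -> alpha != 0 ->
  perm_eq s (iota 0 n ++ iota n n) ->
  (ints s (fun z => (`|\sum_(i < n) smooth_grad p alpha beta i z * z (n + i)%N|)%:E) x
    <= (4 * (2 * d).+1%:R)%:E)%E.
Proof.
move=> pd al0 ps.
pose D N z := `|F (rot (N.+1%:R^-1) z) - F z|.
have mFr t : coord_measurable (fun z => F (rot t z)).
  move=> dd T u mu; apply: coord_measurable_smooth_ptf => j; exact: rotn_measurable.
have nnFr t t' : nnmeas (fun z => (`|F (rot t z) - F (rot t' z)|)%:E).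
  apply: (nnmeas_real (f := fun z => `|F (rot t z) - F (rot t' z)|)) => // dd T u mu.
  by apply: measurableT_comp => //; apply: measurable_funB; exact: mFr.
have rot0 z : F (rot 0 z) = F z.
  by apply: smooth_ptf_local => j jn; rewrite /rotn jn cos0 sin0 mul1r mul0r addr0.
have nnD N : nnmeas (fun z => (D N z)%:E).
  by have := nnFr N.+1%:R^-1 0; under eq_fun do rewrite rot0.
have nnND N : nnmeas (fun z => N.+1%:R%:E * (D N z)%:E)%E.
  split; last by move=> z; rewrite /D -EFinM lee_fin mulr_ge0.
  by move=> dd T u mu; apply: measurable_funeM; exact: (nnmeasP (nnD N)).
(* The limit of difference quotients is written as a lower limit, which is what Fatou's lemma
   bounds. *)
have -> : (fun z => (`|\sum_(i < n) smooth_grad p alpha beta i z * z (n + i)%N|)%:E) =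
    (fun z => limn_einf (fun N => N.+1%:R%:E * (D N z)%:E)%E).
  apply/funext => z; apply/esym.
  have cv := derive_seq (is_derive_smooth_ptf_rot p alpha beta z).
  have {}cv := cvg_norm cv.
  apply: (cvg_limn_einf_sup _).1.
  apply: cvg_EFin; first by apply: nearW => N.
  rewrite [X in X @ _](_ : _ = fun N => `|N.+1%:R * (F (rot (0 + N.+1%:R^-1) z) - F (rot 0 z))|).
    exact: cv.
  by apply/funext => N; rewrite /= /D add0r rot0 normrM ger0_norm.
apply: (le_trans (ints_fatou _ _ nnND)).
(* Increment k is the first increment evaluated after a rotation by [k%:R / N.+1%:R], which
   preserves the Gaussian integral. *)
have rotinv N k : (k < N.+1)%N ->
    ints s (fun z => (`|F (rot (k.+1%:R / N.+1%:R) z) - F (rot (k%:R / N.+1%:R) z)|)%:E) x =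
    ints s (fun z => (D N z)%:E) x.
  move=> kN; have pp : perm_eq s (pairs n n).
    by rewrite (perm_trans ps)// perm_sym perm_pairs.
  rewrite (ints_perm (nnFr _ _) pp) (ints_perm (nnD N) pp).
  have c1 : -1 < cos (k%:R / N.+1%:R) :> R.
    apply: (lt_le_trans (ltrN10 _)); apply: cos_unit_ge0.
    by rewrite divr_ge0//= ler_pdivrMr// mul1r ler_nat ltnW.
  rewrite -(ints_rotn c1 (cos2Dsin2 _) (leqnn n) (nnD N)).
  have thS : k.+1%:R / N.+1%:R = k%:R / N.+1%:R + N.+1%:R^-1 :> R.
    by rewrite -[k.+1%:R]natr1 mulrDl mul1r.
  congr (ints _ _ x); apply/funext => z; rewrite thS -rotn_rotn; exact: erefl.
have sumD N : (ints s (fun z => N.+1%:R%:E * (D N z)%:E) x <= (4 * (2 * d).+1%:R)%:E)%E.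
  rewrite intsZE//.
  have -> : (N.+1%:R%:E * ints s (fun z => (D N z)%:E) x =
      ints s (fun z => \sum_(k < N.+1)
        (`|F (rot (k.+1%:R / N.+1%:R) z) - F (rot (k%:R / N.+1%:R) z)|)%:E) x)%E.
    rewrite ints_sum//= (eq_bigr (fun=> ints s (fun z => (D N z)%:E) x)); last first.
      by move=> k _; exact: rotinv.
    by rewrite sumr_const card_ord mule_natl.
  apply: (@le_trans _ _ (ints s (fun=> (4 * (2 * d).+1%:R)%:E) x)); last first.
    by rewrite ints_frozen.
  apply: le_ints.
  - by apply: nnmeas_sum => k; exact: nnFr.
  - by apply: nnmeas_cst; rewrite lee_fin mulr_ge0.
  - by move=> z; rewrite sumEFin lee_fin; exact: rot_variation_le.
exact: limn_einf_le_cst.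
Qed.

End rotation_average.

(** * Passage to the threshold function *)

Section sensitivity_bound.
Context {R : realType} (n : nat) (p : mpoly.mpoly n R) (d : nat).
Hypothesis pd : (tdeg p <= d)%N.

Lemma smooth_sensitivity_le (alpha beta : R) x : alpha != 0 ->
  (ints (iota 0 n.+1) (fun z => \sum_(i < n)
     (`|smooth_ptf p alpha beta z - smooth_ptf p alpha beta (upd z i (z n))|)%:E) x
   <= (2 * pi * (2 * d).+1%:R * Num.sqrt n%:R)%:E)%E.
Proof.
move=> al0.
apply: (le_trans (sum_resample_le (coord_measurable_smooth_ptf p alpha beta)
  (coord_measurable_smooth_grad p alpha beta)
  (@smooth_ptf_local R n p alpha beta) (@smooth_grad_local R n p alpha beta)
  (@is_derive_smooth_ptf_upd R n p alpha beta)
  (@continuous_smooth_grad_upd R n p alpha beta) x)).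
apply: (@le_trans _ _ ((pi / 2 * Num.sqrt n%:R)%:E * (4 * (2 * d).+1%:R)%:E)%E).
  apply: lee_wpmul2l; last exact: directional_derivative_le.
  by rewrite lee_fin mulr_ge0 ?sqrtr_ge0// divr_ge0// pi_ge0.
by rewrite -EFinM lee_fin le_eqVlt; apply/orP; left; apply/eqP; field.
Qed.

Let f (z : nat -> R) : R := ptf p (fun j : 'I_n => z j).

Lemma coord_measurable_ptf : coord_measurable f.
Proof.
move=> dd T u mu; rewrite /f /ptf /sgn.
apply: measurable_fun_ifT => //.
by apply: measurable_fun_ler => //; exact: coord_measurable_peval.
Qed.

(** The function takes only the values 1 and -1, so its absolute change is 0 or 2. *)
Lemma ptf_indicE (z : nat -> R) (i : nat) :
  (\1_[set z' : nat -> R | f z' != f (upd z' i (z' n))] z : R) =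
  2^-1 * `|f z - f (upd z i (z n))|.
Proof.
rewrite indicE; case: (boolP (f z == f (upd z i (z n)))) => [/eqP E|E].
  rewrite memNset; first by rewrite E subrr normr0 mulr0.
  by rewrite /= E eqxx.
rewrite mem_set//; move: E; rewrite /f /ptf /sgn.
case: ifP => _; case: ifP => _; rewrite ?eqxx// => _.
  by rewrite opprK (_ : 1 + 1 = 2 :> R)// ger0_norm// mulVf.
by rewrite -opprD normrN (_ : 1 + 1 = 2 :> R)// ger0_norm// mulVf.
Qed.

Lemma GAS_ptf_le_sqrt : (GAS (ptf p) <= (pi * (2 * d).+1%:R * Num.sqrt n%:R)%:E)%E.
Proof.
pose I i (z : nat -> R) : \bar R := (2^-1 * `|f z - f (upd z i (z n))|)%:E.
(* The slope [al m] and the shift [m.+1%:R] are those for which the sigmoid tends to [sgn] at every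
   point, zeros of [p] included. *)
pose al m : R := m.+1%:R ^+ 2.
pose S m (z : nat -> R) : \bar R := (\sum_(i < n) (`|smooth_ptf p (al m) m.+1%:R z -
  smooth_ptf p (al m) m.+1%:R (upd z i (z n))|)%:E)%E.
have nnI i : nnmeas (I i).
  apply: (nnmeas_real (f := fun z => 2^-1 * `|f z - f (upd z i (z n))|)) => [dd T u mu|z].
    apply: measurable_funM => //; apply: measurableT_comp => //.
    apply: measurable_funB; first exact: coord_measurable_ptf.
    by apply: coord_measurable_ptf; exact: upd_measurable.
  exact: mulr_ge0.
have nnS m : nnmeas (S m).
  apply: nnmeas_sum => i.
  apply: (nnmeas_real (f := fun z => `|smooth_ptf p (al m) m.+1%:R z -
    smooth_ptf p (al m) m.+1%:R (upd z i (z n))|)) => // dd T u mu.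
  apply: measurableT_comp => //.
  apply: measurable_funB; first exact: coord_measurable_smooth_ptf.
  by apply: coord_measurable_smooth_ptf; exact: upd_measurable.
have nnhS m : nnmeas (fun z => (2^-1)%:E * S m z)%E.
  split; last by move=> z; rewrite mule_ge0//; exact: nnmeas_ge0.
  by move=> dd T u mu; apply: measurable_funeM; exact: (nnmeasP (nnS m)).
have pr : perm_eq (rev (iota 0 n.+1)) (iota 0 n.+1) by rewrite perm_rev.
have -> : GAS (ptf p) = ints (iota 0 n.+1) (fun z => \sum_(i < n) I i z)%E (fun=> 0).
  rewrite ints_sum//; apply: eq_bigr => i _; rewrite /gauss_expect.
  rewrite (_ : (fun z => _) = I i); last first.
    by apply/funext => z; rewrite /I -ptf_indicE.
  by rewrite gauss_iterE// (ints_perm (nnI i) pr).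
have -> : (fun z => \sum_(i < n) I i z)%E =
    (fun z => limn_einf (fun m => (2^-1)%:E * S m z)%E).
  (* The convergence is pointwise everywhere, so the lower limit is the limit; Fatou then carries
     over the bound, which does not depend on m. *)
  apply/funext => z; apply/esym/(cvg_limn_einf_sup _).1.
  rewrite sumEFin; apply: cvg_EFin.
    by apply: nearW => m; rewrite /S sumEFin -EFinM.
  rewrite [X in X @ _](_ : _ = fun m => \sum_(i < n) 2^-1 *
      `|smooth_ptf p (al m) m.+1%:R z - smooth_ptf p (al m) m.+1%:R (upd z i (z n))|).
    apply: cvg_big => [|i _]; first exact: add_continuous.
    apply: cvgMl_tmp; apply: cvg_norm; apply: cvgB.
      exact: cvg_sigmoid_sgn.
    exact: cvg_sigmoid_sgn.
  by apply/funext => m; rewrite /= /S sumEFin /= mulr_sumr.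
apply: (le_trans (ints_fatou _ _ nnhS)); apply: limn_einf_le_cst => m.
rewrite intsZE//.
apply: (@le_trans _ _ ((2^-1)%:E * (2 * pi * (2 * d).+1%:R * Num.sqrt n%:R)%:E)%E).
  apply: lee_wpmul2l; first by rewrite lee_fin.
  by apply: smooth_sensitivity_le; rewrite expf_neq0// pnatr_eq0.
by rewrite -EFinM lee_fin !mulrA mulVf// mul1r.
Qed.

End sensitivity_bound.

Theorem theorem47 (R : realType) (d : nat) (c : R) :
  0 < c ->
  exists C : R,
    forall (n : nat) (p : mpoly.mpoly n R),
      (tdeg p <= d)%N ->
      (GAS (ptf p) <= (C * powR (n%:R) (5 / 6 + c))%:E)%E.
Proof.
move=> c0; exists (pi * (2 * d).+1%:R) => n p pd.
(* For n = 0 the sum is empty. For positive n the base is at least 1, so [1 / 2 <= 5 / 6 + c] lets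
   the stated power dominate the square root. *)
have [n0|n0] := posnP n.
  rewrite /GAS big1; first by rewrite lee_fin !mulr_ge0 ?pi_ge0// powR_ge0.
  by case=> i lin; exfalso; move: lin; rewrite n0.
apply: (le_trans (GAS_ptf_le_sqrt pd)).
rewrite lee_fin ler_wpM2l ?mulr_ge0 ?pi_ge0// -powR12_sqrt ?ler0n//.
apply: ler_powR; first by rewrite ler1n.
by move: c0; lra.
Qed.
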